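(* For every function in the Banach space $\mathcal{K}(\mathbb{R})=A_1\oplus A_2$ the Hilbert transform is well defined at every $x\in\mathbb{R}$. The Hilbert operator $H$ maps $A_1$ to zero. On the space $A_2$ the operator $H$ is isometric, and $HA_2=A_2$. Every function in $A_2$ that is the Fourier transform of a measure $\mu$ concentrated on one of the half-axes $(-\infty,0)$ or $(0,\infty)$ is an eigenfunction of $H$. Every function in $A_2$ is a sum of two eigenfunctions of $H$.
   Context: $M(\mathbb{R})$ is the set of finite complex Borel measures on $\mathbb{R}$; $\widehat\mu(x)=\frac{1}{\sqrt{2\pi}}\int_{-\infty}^\infty e^{-ixt}\,d\mu(t)$; $\mathcal{K}(\mathbb{R})=\{\widehat\mu:\mu\in M(\mathbb{R})\}$ with norm $\|\widehat\mu\|=\frac{1}{\sqrt{2\pi}}\|\mu\|$, where $\|\mu\|$ is the total variation of $\mu$. $A_1$ is the one-dimensional space of constant functions; $A_2$ is the space of those $\widehat\mu\in\mathcal{K}(\mathbb{R})$ with $\mu(\{0\})=0$. The Hilbert transform is $$(Hf)(x)=\mathrm{V.P.}\frac1\pi\int_{-\infty}^\infty\frac{f(t)}{x-t}\,dt=\lim_{\varepsilon\to+0,\ N\to\infty}\frac1\pi\left(\int_{-N}^{x-\varepsilon}\frac{f(t)}{x-t}\,dt+\int_{x+\varepsilon}^{N}\frac{f(t)}{x-t}\,dt\right).$$ An eigenfunction of $H$ is a function $f$ with $Hf=\lambda f$ for some constant $\lambda\in\mathbb{C}$ (the zero function is allowed). *)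

(* Defs.v *)
From HB Require Import structures.
From mathcomp Require Import all_boot all_order all_algebra.
From mathcomp Require Import all_classical all_reals all_analysis.
From mathcomp Require Import complex.

Set Implicit Arguments.
Unset Strict Implicit.
Unset Printing Implicit Defensive.

Import Order.TTheory GRing.Theory Num.Theory.
Import numFieldNormedType.Exports.
Import ComplexField.

Local Open Scope classical_set_scope.
Local Open Scope ring_scope.
Local Open Scope complex_scope.

(* Normed spaces of functions R -> C: a space is given by its carrier V, a set
   of functions, and a norm N, of which only the values on V matter. *)
Section FunctionSpaces.
Context {R : realType}.
Implicit Types (V A B : set (R -> R[i])) (N : (R -> R[i]) -> R).

Definition is_subspace V : Prop :=
  V 0 /\ forall (a : R[i]) f g, V f -> V g -> V (a *: f + g).

Definition is_norm_on V N : Prop :=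
  [/\ forall f, V f -> N f = 0 -> f = 0,
      forall (a : R[i]) f, V f -> N (a *: f) = Normc.normc a * N f &
      forall f g, V f -> V g -> N (f + g) <= N f + N g].

Definition is_complete V N : Prop :=
  forall u : nat -> R -> R[i], (forall n, V (u n)) ->
    (forall e : R, 0 < e -> exists n0 : nat, forall m n : nat,
       (n0 <= m)%N -> (n0 <= n)%N -> N (u m - u n) < e) ->
    exists2 f, V f & (fun n => N (u n - f)) @ \oo --> (0 : R).

Definition is_banach_space V N : Prop :=
  [/\ is_subspace V, is_norm_on V N & is_complete V N].

Definition is_closed_subspace V N A : Prop :=
  [/\ is_subspace A, A `<=` V &
      forall (u : nat -> R -> R[i]) f, (forall n, A (u n)) -> V f ->
        (fun n => N (u n - f)) @ \oo --> (0 : R) -> A f].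

Definition is_direct_sum V N A B : Prop :=
  [/\ is_closed_subspace V N A, is_closed_subspace V N B,
      V = [set f | exists g h, [/\ A g, B h & f = g + h]] &
      A `&` B = [set 0]].

End FunctionSpaces.

(* Integral of a complex-valued function against a positive measure. *)
Section ComplexIntegral.
Context d (T : measurableType d) (R : realType).
Implicit Types (mu : {measure set T -> \bar R}) (D : set T) (f : T -> R[i]).

Definition cintegrable mu D f : Prop :=
  mu.-integrable D (fun t => (complex.Re (f t))%:E) /\
  mu.-integrable D (fun t => (complex.Im (f t))%:E).

Definition cintegral mu D f : R[i] :=
  (\int[mu]_(t in D) complex.Re (f t)) +i* (\int[mu]_(t in D) complex.Im (f t)).

End ComplexIntegral.

Section ComplexMeasures.
Context d (T : measurableType d) (R : realType).

Definition hahn_sets (nu : {charge set T -> \bar R}) :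
  {PN : set T * set T | hahn_decomposition nu PN.1 PN.2}.
Proof.
apply: cid.
by have [P [N nuPN]] := Hahn_decomposition nu; exists (P, N).
Qed.

(* A Hahn decomposition is unique up to null sets, so the measures
   jordan_pos and jordan_neg do not depend on the one that is chosen. *)
Definition charge_integral (nu : {charge set T -> \bar R}) (f : T -> R) : R :=
  (\int[jordan_pos (svalP (hahn_sets nu))]_t f t)
  - (\int[jordan_neg (svalP (hahn_sets nu))]_t f t).

(* A finite complex measure is mu_re + i mu_im with mu_re and mu_im finite
   signed measures (the library's charges are finite by definition). *)
Record complex_measure := ComplexMeasure {
  cm_re : {charge set T -> \bar R} ;
  cm_im : {charge set T -> \bar R} }.

Definition cm_value (mu : complex_measure) (A : set T) : R[i] :=
  fine (cm_re mu A) +i* fine (cm_im mu A).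

Definition cm_integral (mu : complex_measure) (f : T -> R[i]) : R[i] :=
  (charge_integral (cm_re mu) (fun t => complex.Re (f t))
     - charge_integral (cm_im mu) (fun t => complex.Im (f t))) +i*
  (charge_integral (cm_re mu) (fun t => complex.Im (f t))
     + charge_integral (cm_im mu) (fun t => complex.Re (f t))).

Definition countable_partition (F : nat -> set T) : Prop :=
  [/\ forall k, measurable (F k), trivIset setT F & \bigcup_k F k = setT].

Definition cm_variation (mu : complex_measure) : \bar R :=
  ereal_sup [set (\sum_(0 <= k <oo) (Normc.normc (cm_value mu (F k)))%:E)%E
            | F in countable_partition].

Definition cm_norm (mu : complex_measure) : R := fine (cm_variation mu).

Definition concentrated_on (mu : complex_measure) (D : set T) : Prop :=
  forall A, measurable A -> A `&` D = set0 -> cm_value mu A = 0.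

End ComplexMeasures.

Section FourierStieltjes.
Context {R : realType}.

(* M(R): the sigma-algebra of measurableTypeR R is the Borel one. *)
Definition M_R : Type := complex_measure (measurableTypeR R) R.

(* exp (- i s) *)
Definition expmi (s : R) : R[i] := cos s -i* sin s.

Definition fourier (mu : M_R) (x : R) : R[i] :=
  ((Num.sqrt (2 * pi))^-1)%:C * cm_integral mu (fun t => expmi (x * t)).

Definition K_space : set (R -> R[i]) := [set f | exists mu, f = fourier mu].

(* The value that is picked is the only one since the Fourier transform is
   injective on M(R); it is 0 outside K_space. *)
Definition K_norm (f : R -> R[i]) : R :=
  xget 0 [set v | exists2 mu, f = fourier mu &
                  v = (Num.sqrt (2 * pi))^-1 * cm_norm mu].

Definition A1_space : set (R -> R[i]) := [set f | exists c, f = fun=> c].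

Definition A2_space : set (R -> R[i]) :=
  [set f | exists2 mu, f = fourier mu & cm_value mu [set 0] = 0].

End FourierStieltjes.
Arguments M_R : clear implicits.

Section HilbertTransform.
Context {R : realType}.
Implicit Types (f : R -> R[i]) (x : R).

Definition hilbert_kernel f x (t : R) : R[i] := f t / (x - t)%:C.

(* The regular algebra R[i]^o is R[i] with its usual topology. *)
Definition hilbert_truncation f x (p : R * R) : R[i]^o :=
  let: (e, N) := p in
  (pi^-1)%:C *
    (cintegral lebesgue_measure `[- N, x - e] (hilbert_kernel f x)
     + cintegral lebesgue_measure `[x + e, N] (hilbert_kernel f x)).

(* (e, N) with e -> +0 and N -> oo independently *)
Definition hilbert_filter : set_system (R * R) :=
  filter_prod (0 : R)^'+ (pinfty_nbhs R).

Definition hilbert_defined_at f x : Prop :=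
  (forall e N : R, 0 < e ->
     cintegrable lebesgue_measure `[- N, x - e] (hilbert_kernel f x) /\
     cintegrable lebesgue_measure `[x + e, N] (hilbert_kernel f x)) /\
  cvg (hilbert_truncation f x @ hilbert_filter).

Definition hilbert f x : R[i] :=
  lim (hilbert_truncation f x @ hilbert_filter).

Definition is_hilbert_eigenfunction f : Prop :=
  (forall x, hilbert_defined_at f x) /\
  exists lam : R[i], hilbert f = lam *: f.

End HilbertTransform.

(* Main.v *)
(** For a finite positive measure [m], Fubini turns the truncated Hilbert integral of
    [x |-> \int cos (x t - th) dm(t)] into the [m]-integral of truncated Hilbert transforms of single
    waves.  By the Dirichlet integral these are uniformly bounded and converge to
    [pi sgn(t) sin (x t - th)], so dominated convergence and linearity yield, at every point,
    that [H] maps the Fourier transform of [mu] to that of [i sgn(t) mu].  Thus [H] forgets the atom at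
    [0], and on [A2] it multiplies [mu] by [i] on the positive and by [-i] on the negative half-axis:
    an isometry whose square is [-1], with eigenvalues [i] and [-i].

    The same formula gives injectivity of the Fourier transform: after multiplying by [exp (i a x)],
    its value at [x = 0] is determined by [mu (a, oo) - mu (-oo, a)], and these differences
    for all [a] determine [mu].  Completeness holds because the total variation controls the values of
    a complex measure uniformly on all measurable sets. *)
Require Import Defs.
From HB Require Import structures.
From mathcomp Require Import all_boot all_order all_algebra.
From mathcomp Require Import all_classical all_reals all_analysis.
From mathcomp Require Import complex.
From mathcomp Require Import measurable_realfun ring lra.
Import Order.TTheory GRing.Theory Num.Theory.
Import numFieldNormedType.Exports.
Local Open Scope classical_set_scope.
Local Open Scope ring_scope.

Set Implicit Arguments.
Unset Strict Implicit.
Unset Printing Implicit Defensive.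

(** * Real integrals *)

Section RealPreliminaries.
Context {R : realType}.

(** One real family carries all the analysis: the integrals of [cos (x * phi t - th)] against a
    finite measure. The phase [th] selects cosine or minus sine, hence real and imaginary parts; the
    map [phi] is the identity for the transform of a measure and [t - a] for the uniqueness
    argument. Two obstacles shape the estimates. The integral of [cos (u p) / u] has no bound
    uniform in the truncation, and the cosine parts on the two sides of [x] cancel only up to a
    remainder, because the window [[-N, N]] is centred at [0] and not at [x]; the remainder lives
    between [N - |x|] and [N + |x|] and tends to [0]. Moreover [e] and [N] reach their limits
    independently, whereas dominated convergence concerns sequences, so limits along the filter are
    tested on sequences. On the side of measures, Jordan parts are not linear in the charge, so
    linearity of the integral in the measure is derived from relations between values on sets.
    Injectivity of the transform also makes [K_norm] independent of the representing measure. *)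

Lemma continuous_invr_neq0 (x : R) : x != 0 -> {for x, continuous (fun y : R => y^-1)}.
Proof. by move=> x0; apply: cvgV => //; exact: cvg_id. Qed.

Lemma measurable_invr : measurable_fun [set: R] (fun x : R => x^-1).
Proof.
rewrite -(setvU [set (0 : R)]); apply/measurable_funU.
- exact: measurableC.
- exact: measurable_set1.
split; last exact: measurable_fun_set1.
apply: open_continuous_measurable_fun.
  by apply: closed_openC; apply: accessible_closed_set1; exact: hausdorff_accessible (@Rhausdorff R).
by move=> x; rewrite inE /= => /eqP; exact/continuous_invr_neq0.
Qed.

Lemma measurable_sin : measurable_fun [set: R] (@sin R).
Proof. by apply: continuous_measurable_fun; exact: continuous_sin. Qed.

Lemma measurable_cos : measurable_fun [set: R] (@cos R).
Proof. by apply: continuous_measurable_fun; exact: continuous_cos. Qed.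

Lemma ler_norm_sin (x : R) : `|sin x| <= `|x|.
Proof.
wlog x0 : x / 0 <= x.
  move=> H; case: (leP 0 x) => [/H//|x0].
  by have := H (- x); rewrite sinN !normrN; apply; rewrite oppr_ge0 ltW.
have [|c _] := @MVT_segment R sin cos 0 x x0 (fun y _ => is_derive_sin y).
  by apply: continuous_subspaceT; exact: continuous_sin.
rewrite sin0 !subr0 => ->; rewrite normrM.
by rewrite ler_piMl// cos_max.
Qed.

Lemma bounded_integrable d (T : measurableType d) (m : {measure set T -> \bar R})
    (D : set T) (f : T -> R) (M : R) : measurable D -> (m D < +oo)%E ->
  measurable_fun D f -> (forall x, D x -> `|f x| <= M) ->
  m.-integrable D (EFin \o f).
Proof.
move=> mD mDoo mf fM; apply: measurable_bounded_integrable => //.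
exists M; split; first exact: num_real.
by move=> N MN x Dx; exact: le_trans (fM x Dx) (ltW MN).
Qed.

Lemma integrable_scalel d (T : measurableType d) (m : {measure set T -> \bar R})
    (D : set T) (f : T -> R) (c : R) : measurable D ->
  m.-integrable D (EFin \o f) -> m.-integrable D (EFin \o (fun x => c * f x)).
Proof. by move=> mD /(integrableZl mD c); exact: eq_integrable. Qed.

Lemma bounded_Rintegral d (T : measurableType d) (m : {measure set T -> \bar R})
    (D : set T) (f : T -> R) (M : R) : measurable D -> (m D < +oo)%E ->
  measurable_fun D f -> (forall x, D x -> `|f x| <= M) ->
  `|\int[m]_(x in D) f x| <= M * fine (m D).
Proof.
move=> mD mDoo mf fM; have itf := bounded_integrable mD mDoo mf fM.
apply: le_trans (le_normr_Rintegral mD itf) _.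
rewrite -Rintegral_cst//; apply: le_Rintegral => //.
  by have := integrable_norm itf.
apply: (@bounded_integrable _ _ _ _ (cst M) `|M|) => //.
Qed.

Notation mu := (@lebesgue_measure R).

Lemma lebesgue_itv_lty (b1 b2 : bool) (a b : R) :
  (mu [set` Interval (BSide b1 a) (BSide b2 b)] < +oo)%E.
Proof. by rewrite lebesgue_measure_itv/=; case: ifP => _; rewrite ?ltry// -EFinB ltry. Qed.

(** * Fubini's theorem on a rectangle, for a dominated integrand *)

Section FubiniOn.
Context d1 d2 (T1 : measurableType d1) (T2 : measurableType d2).
Variables (m1 : {sigma_finite_measure set T1 -> \bar R}).
Variables (m2 : {sigma_finite_measure set T2 -> \bar R}).
Variables (D1 : set T1) (D2 : set T2).
Hypotheses (mD1 : measurable D1) (mD2 : measurable D2).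
Variables (f : T1 * T2 -> R) (g : T1 -> R).
Hypotheses (mf : measurable_fun [set: T1 * T2] f) (ig : m1.-integrable D1 (EFin \o g)).
Hypothesis fg : forall x, D1 x -> (\int[m2]_(y in D2) `|f (x, y)|%:E <= (g x)%:E)%E.

Let F : T1 * T2 -> \bar R := (EFin \o f) \_ (D1 `*` D2).

Let mF : measurable_fun [set: T1 * T2] F.
Proof.
apply/(measurable_restrictT _ _).1; first exact: measurableX.
by apply: measurable_funTS; exact/measurable_EFinP.
Qed.

Let Fl x y : F (x, y) = ((fun x => ((EFin \o (fun y => f (x, y))) \_ D2) y) \_ D1) x.
Proof.
rewrite /F !patchE /= in_setX /=.
by case: (x \in D1); case: (y \in D2) => //=; rewrite patchE.
Qed.

Let Fr x y : F (x, y) = ((fun y => ((EFin \o (fun x => f (x, y))) \_ D1) x) \_ D2) y.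
Proof. by rewrite Fl !patchE; case: (x \in D1); case: (y \in D2). Qed.

Let intF1 x : (\int[m2]_y F (x, y) =
  ((fun x => \int[m2]_(y in D2) (f (x, y))%:E) \_ D1) x)%E.
Proof.
rewrite patchE; case: ifPn => xD1.
  by rewrite [RHS]integral_mkcond; apply: eq_integral => y _; rewrite Fl patchE xD1.
by rewrite integral0_eq// => y _; rewrite Fl patchE (negbTE xD1).
Qed.

Let intF2 y : (\int[m1]_x F (x, y) =
  ((fun y => \int[m1]_(x in D1) (f (x, y))%:E) \_ D2) y)%E.
Proof.
rewrite patchE; case: ifPn => yD2.
  by rewrite [RHS]integral_mkcond; apply: eq_integral => x _; rewrite Fr patchE yD2.
by rewrite integral0_eq// => x _; rewrite Fr patchE (negbTE yD2).
Qed.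

(** By Tonelli it is enough that the iterated integral of the absolute value is finite, and its
    inner integral is dominated by the integrable [g]. Extension by zero outside [D1 x D2] then
    reduces everything to Fubini on the whole product. *)
Let iF : (m1 \x m2)%E.-integrable [set: T1 * T2] F.
Proof.
apply/integrable12ltyP => //.
have -> : (\int[m1]_x \int[m2]_y `|F (x, y)| =
           \int[m1]_(x in D1) \int[m2]_(y in D2) `|f (x, y)|%:E)%E.
  rewrite [RHS]integral_mkcond; apply: eq_integral => x _; rewrite patchE.
  case: ifPn => xD1.
    rewrite [RHS]integral_mkcond; apply: eq_integral => y _.
    by rewrite Fl !patchE xD1; case: ifPn => // _; exact: abse0.
  rewrite integral0_eq// => y _; rewrite Fl patchE (negbTE xD1).
  exact: abse0.
have [mg goo] := integrableP _ _ _ ig.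
apply: le_lt_trans goo; apply: ge0_le_integral => //.
- by move=> x _; apply: integral_ge0 => y _; rewrite lee_fin.
- pose h := fun z => `|F z|%E.
  have mh : measurable_fun [set: T1 * T2] h by exact: measurableT_comp.
  have := measurable_fun_fubini_tonelli_F (m2 := m2) h mh (fun=> abse_ge0 _).
  move=> /(measurable_funTS) -/(_ D1); apply: eq_measurable_fun => x xD1.
  rewrite /fubini_F [RHS]integral_mkcond; apply: eq_integral => y _.
  by rewrite /h Fl !patchE xD1; case: ifPn => // _; exact: abse0.
- exact: measurableT_comp.
- move=> x D1x; apply: le_trans (fg D1x) _.
  by rewrite /= lee_fin ler_norm.
Qed.

Lemma Fubini_on : (\int[m1]_(x in D1) \int[m2]_(y in D2) (f (x, y))%:E =
  \int[m2]_(y in D2) \int[m1]_(x in D1) (f (x, y))%:E)%E.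
Proof.
rewrite integral_mkcond [RHS]integral_mkcond.
rewrite -(eq_integral _ _ (fun x _ => intF1 x)) -(eq_integral _ _ (fun x _ => intF2 x)).
exact: Fubini.
Qed.

Lemma Fubini_on_integrable1 :
  m1.-integrable D1 (fun x => \int[m2]_(y in D2) (f (x, y))%:E)%E.
Proof.
have := integrable_fubini_F iF; rewrite /fubini_F => H.
apply/(integrable_mkcond _ mD1).2; exact: eq_integrable H.
Qed.

Lemma Fubini_on_measurable2 :
  measurable_fun D2 (fun y => \int[m1]_(x in D1) (f (x, y))%:E)%E.
Proof.
have := measurable_funTS (D := D2) (measurable_fubini_G iF); rewrite /fubini_G.
apply: eq_measurable_fun => y yD2.
by rewrite intF2 patchE yD2.
Qed.

End FubiniOn.

End RealPreliminaries.

(** * The Dirichlet integral *)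

Section Dirichlet.
Context {R : realType}.
Notation mu := (@lebesgue_measure R).

Let is_derive_expR_lin (c y : R) : is_derive y 1 (fun y => expR (- (c * y))) (- c * expR (- (c * y))).
Proof.
have h : is_derive y 1 (fun y : R => - (c * y)) (- c).
  apply: (is_derive_eq (is_deriveN (is_deriveZ c (is_derive_id y 1)))).
  by rewrite /GRing.scale /= mulr1.
apply: (is_derive_eq (@is_derive1_comp R expR (fun y => - (c * y)) y _ _ (is_derive_expR _) h)).
by rewrite mulrC.
Qed.

Let continuous_derive (f df : R -> R) : (forall x : R, is_derive x 1 f (df x)) -> continuous f.
Proof. by move=> h x; apply/differentiable_continuous/derivable1_diffP; exact: ex_derive. Qed.

Lemma integral_expR_decay (c : R) : 0 < c ->
  (\int[mu]_(y in `[0%R, +oo[) (expR (- (c * y)))%:E = (c^-1)%:E)%E.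
Proof.
move=> c0.
pose F y : R := - (c^-1 * expR (- (c * y))).
have dF (y : R) : is_derive y 1 F (expR (- (c * y))).
  apply: (is_derive_eq (is_deriveN (is_deriveZ (c^-1) (is_derive_expR_lin c y)))).
  rewrite /GRing.scale /=.
  by rewrite mulrA mulrN mulVf ?gt_eqF// mulN1r opprK.
rewrite (@ge0_continuous_FTC2y _ _ F 0 0).
- by rewrite /F mulr0 oppr0 expR0 mulr1 EFinN oppeK add0e.
- by move=> y _; exact: expR_ge0.
- apply: continuous_subspaceT.
  by apply: continuous_derive => y; exact: is_derive_expR_lin.
- rewrite /F -oppr0 -[X in - X](mulr0 c^-1).
  apply: cvgN; apply: cvgMl_tmp.
  apply: (@cvg_comp _ _ _ (fun y => c * y) (fun z => expR (- z)) _ +oo); last exact: cvgr_expR.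
  exact: gt0_cvgMry.
- by move=> y _; exact: ex_derive.
- by apply: cvg_at_right_filter; exact: (continuous_derive dF).
- by move=> y _; rewrite derive1E; exact: derive_val.
Qed.

(** Up to sign, an antiderivative in [a] of [sin a * exp (- a y)]. *)
Let G (a y : R) : R := expR (- (a * y)) * (y * sin a + cos a) / oneDsqr y.

Lemma integral_sin_decay (p y M : R) : 0 < M ->
  (\int[mu]_(u in `]0%R, M]) (sin (u * p) * (p * expR (- (u * p * y))))%:E =
   ((oneDsqr y)^-1 - G (M * p) y)%:E)%E.
Proof.
move=> M0.
pose F u : R := - G (u * p) y.
pose f u : R := sin (u * p) * (p * expR (- (u * p * y))).
have dl (u : R) : is_derive u 1 (fun u : R => u * p) p.
  apply: (is_derive_eq (is_deriveM (is_derive_id u 1) (is_derive_cst p u 1))).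
  by rewrite /GRing.scale /= mulr0 mulr1 add0r.
have ds (u : R) : is_derive u 1 (fun u : R => sin (u * p)) (cos (u * p) * p).
  exact: (@is_derive1_comp R sin (fun u => u * p) u _ _ (is_derive_sin _) (dl u)).
have dc (u : R) : is_derive u 1 (fun u : R => cos (u * p)) (- sin (u * p) * p).
  exact: (@is_derive1_comp R cos (fun u => u * p) u _ _ (is_derive_cos _) (dl u)).
have de (u : R) : is_derive u 1 (fun u : R => expR (- (u * p * y)))
    (- (p * y) * expR (- (u * p * y))).
  have := is_derive_expR_lin (p * y) u.
  have -> : (fun u : R => expR (- (u * p * y))) = (fun u => expR (- (p * y * u))).
    by apply/funext => v; congr (expR (- _)); ring.
  by have -> : u * p * y = p * y * u by ring.
have dF (u : R) : is_derive u 1 F (f u).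
  rewrite /F /G.
  have d1 := is_deriveD (is_deriveM (is_derive_cst y u 1) (ds u)) (dc u).
  have d2 := is_deriveM (de u) d1.
  apply: (is_derive_eq (is_deriveN (is_deriveM d2 (is_derive_cst (oneDsqr y)^-1 u 1)))).
  rewrite /GRing.scale /= /f !fctE.
  have : oneDsqr y != 0 by rewrite gt_eqF.
  rewrite /oneDsqr => y0; field.
  exact: y0.
have cf : continuous f.
  move=> u; apply: cvgM; first exact: (continuous_derive ds).
  by apply: cvgM; [exact: cvg_cst|exact: (continuous_derive de)].
rewrite integral_itv_obnd_cbnd; last first.
  by apply/measurable_EFinP; apply: measurable_funTS; exact: continuous_measurable_fun.
rewrite (@continuous_FTC2 _ f F 0 M)//.
- rewrite /F /G !mul0r oppr0 expR0 sin0 cos0 mulr0 add0r !mul1r.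
  by rewrite -EFinB opprK addrC.
- exact: continuous_subspaceT.
- split.
  + by move=> u _; exact: ex_derive.
  + by apply: cvg_at_right_filter; exact: (continuous_derive dF).
  + by apply: cvg_at_left_filter; exact: (continuous_derive dF).
- by move=> u _; rewrite derive1E; exact: derive_val.
Qed.

(** The constant comes from [|y sin a + cos a| <= y + 1 <= 2 (1 + y^2)]. *)
Lemma G_bound (a y : R) : 0 <= y -> `|G a y| <= 2 * expR (- (a * y)).
Proof.
move=> y0; rewrite /G !normrM (ger0_norm (expR_ge0 _)).
rewrite -mulrA [2 * _]mulrC; apply: ler_wpM2l; first exact: expR_ge0.
have o0 : 0 < oneDsqr y by [].
rewrite normfV (gtr0_norm o0) ler_pdivrMr//.
have h1 : `|y * sin a + cos a| <= y + 1.
  apply: le_trans (ler_normD _ _) _; apply: lerD; last exact: cos_max.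
  by rewrite normrM (ger0_norm y0) ler_piMr// sin_max.
by apply: le_trans h1 _; rewrite /oneDsqr; nra.
Qed.

Definition sine_int (p M : R) : R := \int[mu]_(u in `]0, M]) (sin (u * p) / u).

Lemma integrable_expR_decay (c : R) : 0 < c ->
  mu.-integrable `[0, +oo[ (fun y => (expR (- (c * y)))%:E).
Proof.
move=> c0; apply/integrableP; split.
  apply/measurable_EFinP; apply: measurable_funTS; apply: continuous_measurable_fun.
  by apply: continuous_derive => y; exact: is_derive_expR_lin.
under eq_integral => y _ do rewrite /= ger0_norm ?expR_ge0//.
by rewrite integral_expR_decay// ltry.
Qed.

Lemma measurable_sine_quot (p : R) : measurable_fun [set: R] (fun u => sin (u * p) / u).
Proof.
apply: measurable_funM; last exact: measurable_invr.
by apply: measurableT_comp; [exact: measurable_sin|exact: measurable_funM].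
Qed.

Lemma sine_quot_bound (p u : R) : `|sin (u * p) / u| <= `|p|.
Proof.
have [->|u0] := eqVneq u 0; first by rewrite invr0 mulr0 normr0.
rewrite normrM normfV ler_pdivrMr ?normr_gt0//.
by apply: le_trans (ler_norm_sin _) _; rewrite normrM mulrC.
Qed.

(** The exponent is scaled by [p] so that the leading term of the [u]-integral, [1 / (1 + y^2)],
    does not depend on [p]. *)
Let f p (z : R * R) : R := sin (z.1 * p) * (p * expR (- (z.1 * p * z.2))).

Let mf p : measurable_fun [set: measurableTypeR R * measurableTypeR R] (f p).
Proof.
have m1 : measurable_fun [set: measurableTypeR R * measurableTypeR R]
    (fun z => z.1 * p).
  by apply: measurable_funM => //; exact: measurable_fst.
apply: measurable_funM; first exact: (measurableT_comp measurable_sin).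
apply: measurable_funM => //; apply: measurableT_comp => //.
apply: measurableT_comp => //; apply: measurable_funM => //.
Qed.

Let inner (p u : R) : 0 < p -> 0 < u ->
  (\int[mu]_(y in `[0%R, +oo[) (f p (u, y))%:E = (sin (u * p) / u)%:E)%E.
Proof.
move=> p0 u0; have up0 : 0 < u * p by rewrite mulr_gt0.
rewrite /f /=; under eq_integral => y _ do rewrite mulrA EFinM.
rewrite integralZl//; last exact: integrable_expR_decay.
rewrite integral_expR_decay// -EFinM; congr EFin; field.
by rewrite !gt_eqF.
Qed.

Let inner_norm (p u : R) : 0 < p -> 0 < u ->
  (\int[mu]_(y in `[0%R, +oo[) `|f p (u, y)|%:E = `|sin (u * p) / u|%:E)%E.
Proof.
move=> p0 u0; have up0 : 0 < u * p by rewrite mulr_gt0.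
rewrite /f /=.
under eq_integral => y _.
  rewrite normrM normrM (gtr0_norm p0) (ger0_norm (expR_ge0 _)) mulrA EFinM; over.
rewrite integralZl//; last exact: integrable_expR_decay.
rewrite integral_expR_decay// -EFinM normrM normfV (gtr0_norm u0).
congr EFin; field.
by rewrite !gt_eqF.
Qed.

Let sine_int_G (p M : R) : 0 < p -> 0 < M ->
  sine_int p M = \int[mu]_(y in `[0, +oo[) ((oneDsqr y)^-1 - G (M * p) y).
Proof.
move=> p0 M0; rewrite /sine_int /Rintegral; congr fine.
transitivity (\int[mu]_(u in `]0%R, M]) \int[mu]_(y in `[0%R, +oo[) (f p (u, y))%:E)%E.
  apply: eq_integral => u; rewrite inE /= in_itv /= => /andP[u0 _].
  by rewrite inner.
(* For fixed [u] the absolute values integrate over [y] to [|sin (u p) / u| <= p], so the constant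
   [p] on the bounded interval is the dominating function. *)
rewrite (@Fubini_on R _ _ _ _ mu mu _ _ _ _ (f p) (cst p))//.
- by apply: eq_integral => y _; rewrite integral_sin_decay.
- apply: (@bounded_integrable _ _ _ _ _ _ `|p|) => //.
  exact: lebesgue_itv_lty.
- move=> u; rewrite /= in_itv /= => /andP[u0 _].
  rewrite inner_norm// lee_fin (le_trans (sine_quot_bound _ _))//.
  by rewrite gtr0_norm.
Qed.

Lemma integrable_oneDsqrV : mu.-integrable `[0, +oo[ (fun y : R => (oneDsqr y)^-1%:E).
Proof.
apply/integrableP; split.
  apply/measurable_EFinP; apply: measurable_funTS; apply: continuous_measurable_fun.
  exact: continuous_oneDsqrV.
under eq_integral => y _ do rewrite /= ger0_norm ?invr_ge0//.
by rewrite integral0y_oneDsqr ltry.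
Qed.

Let measurable_G (a : R) : measurable_fun [set: R] (G a).
Proof.
apply: measurable_funM; last first.
  by apply: continuous_measurable_fun; exact: continuous_oneDsqrV.
apply: measurable_funM.
  apply: continuous_measurable_fun.
  by apply: continuous_derive => y; exact: is_derive_expR_lin.
by apply: measurable_funD => //; exact: measurable_funM.
Qed.

Let integrable_G (a : R) : 0 < a -> mu.-integrable `[0, +oo[ (EFin \o G a).
Proof.
move=> a0.
have m0 : measurable (`[(0 : R), +oo[ : set (measurableTypeR R)) by exact: measurable_itv.
have ig := integrableZl m0 2 (integrable_expR_decay a0).
apply: (le_integrable m0 _ _ ig).
- by apply/measurable_EFinP; apply: measurable_funTS; exact: measurable_G.
- move=> y; rewrite /= in_itv /= andbT => y0.
  apply: le_trans (_ : (2 * expR (- (a * y)))%:E <= _)%E; first by rewrite lee_fin G_bound.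
  exact: lee_abs.
Qed.

(* Fubini after writing [1 / u] as the integral of [p * exp (- u p y)] over [y >= 0]: the integral over
   [u] is [1 / (1 + y^2) - G (M * p) y], and the first term integrates to [pi / 2]. *)
Lemma sine_int_pos (p M : R) : 0 < p -> 0 < M ->
  `|sine_int p M - pi / 2| <= 2 / (M * p).
Proof.
move=> p0 M0; have Mp : 0 < M * p by rewrite mulr_gt0.
rewrite sine_int_G// RintegralB//; last 2 first.
- exact: integrable_oneDsqrV.
- exact: integrable_G.
have -> : \int[mu]_(y in `[0, +oo[) (oneDsqr y)^-1 = pi / 2.
  by rewrite /Rintegral integral0y_oneDsqr.
rewrite addrAC subrr add0r normrN.
apply: le_trans (le_normr_Rintegral _ (integrable_G Mp)) _ => //.
rewrite -lee_fin /Rintegral fineK; last first.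
  by apply: integrable_fin_num => //; have := integrable_norm (integrable_G Mp).
(* The rate [2 / (M * p)] is the integral of the bound [2 exp (- M p y)] for the remainder. *)
apply: (@le_trans _ _ (\int[mu]_(y in `[0%R, +oo[) (2 * expR (- ((M * p) * y)))%:E)%E).
  apply: ge0_le_integral => //.
  - by apply/measurable_EFinP; apply: measurableT_comp => //; apply: measurable_funTS; exact: measurable_G.
  - apply/measurable_EFinP; apply: measurable_funTS; apply: measurable_funM => //.
    apply: continuous_measurable_fun.
    by apply: continuous_derive => y; exact: is_derive_expR_lin.
  - by move=> y; rewrite /= in_itv /= andbT => y0; rewrite lee_fin G_bound.
under eq_integral => y _ do rewrite EFinM.
rewrite integralZl//; last exact: integrable_expR_decay.
by rewrite integral_expR_decay.
Qed.

End Dirichlet.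

(** * Truncated Hilbert transforms of a single wave *)

Section Kernel.
Context {R : realType}.
Notation mu := (@lebesgue_measure R).

Lemma bounded_Rintegral_itv (a b M : R) (f : R -> R) : a <= b ->
  measurable_fun [set: R] f -> (forall x, x \in `]a, b] -> `|f x| <= M) ->
  `|\int[mu]_(x in `]a, b]) f x| <= M * (b - a).
Proof.
move=> ab mf fM.
have -> : b - a = fine (mu `]a, b]).
  rewrite lebesgue_measure_itv /= lte_fin.
  by case: ltgtP ab => [//|//|->]; rewrite subrr.
apply: bounded_Rintegral => //; first exact: lebesgue_itv_lty.
exact: measurable_funTS.
Qed.

Lemma sine_intN (p M : R) : sine_int (- p) M = - sine_int p M.
Proof.
rewrite -[RHS]mulN1r /sine_int -(@RintegralZl _ _ _ mu _ (fun u => sin (u * p) / u))//; last first.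
  apply: (@bounded_integrable _ _ _ _ _ _ `|p|) => //; first exact: lebesgue_itv_lty.
    by apply: measurable_funTS; exact: measurable_sine_quot.
  by move=> u _; exact: sine_quot_bound.
by apply: eq_Rintegral => u _; rewrite mulrN sinN mulN1r mulNr.
Qed.

Lemma sine_int_le (p M : R) : 0 <= M -> `|sine_int p M| <= M * `|p|.
Proof.
move=> M0; rewrite /sine_int.
rewrite -[X in X * _](subr0 M) mulrC; apply: bounded_Rintegral_itv => //.
  exact: measurable_sine_quot.
by move=> u _; exact: sine_quot_bound.
Qed.

Lemma sine_int0 (M : R) : sine_int 0 M = 0.
Proof.
rewrite /sine_int; under eq_Rintegral => u _ do rewrite mulr0 sin0 mul0r.
by rewrite Rintegral_cst// mul0r.
Qed.

(* At [p = 0] the right-hand side is [2 / 0 = 0], and the left-hand side vanishes too. *)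
Lemma sine_int_sg (p M : R) : 0 < M ->
  `|sine_int p M - Num.sg p * (pi / 2)| <= 2 / (M * `|p|).
Proof.
move=> M0; have [p0|p0|->] := ltgtP p 0.
- rewrite ltr0_sg// mulN1r (ltr0_norm p0).
  have := @sine_int_pos R (- p) M; rewrite oppr_gt0 => /(_ p0 M0).
  by rewrite sine_intN -opprD normrN opprK.
- by rewrite gtr0_sg// mul1r (gtr0_norm p0) sine_int_pos.
- by rewrite sgr0 mul0r subr0 sine_int0 !normr0 mulr0 invr0 mulr0.
Qed.

(** Uniform in both [p] and [M], as domination requires. For [M |p| <= 1] the integrand bound [|p|]
    already gives [1]; beyond, the distance [2 / (M |p|)] to the Dirichlet value [+- pi / 2] is at
    most [2]. *)
Lemma sine_int_bound (p M : R) : 0 < M -> `|sine_int p M| <= pi / 2 + 2.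
Proof.
move=> M0; have pi0 := pi_ge0 R.
have [Mp|Mp] := leP (M * `|p|) 1.
  apply: le_trans (sine_int_le p (ltW M0)) _; apply: le_trans Mp _.
  by rewrite -[leLHS]add0r lerD ?divr_ge0// ler1n.
rewrite -(subrK (Num.sg p * (pi / 2)) (sine_int p M)).
apply: le_trans (ler_normD _ _) _; rewrite addrC; apply: lerD.
  rewrite normrM (@ger0_norm _ (pi / 2)) ?divr_ge0// ler_piMl ?divr_ge0//.
  by rewrite normr_sg; case: (p != 0).
apply: le_trans (sine_int_sg p M0) _.
by rewrite ler_pdivrMr ?(lt_trans _ Mp)// ler_peMr// ltW.
Qed.

Lemma sine_int_sub (p e M : R) : 0 < e -> e <= M ->
  \int[mu]_(u in `[e, M]) (sin (u * p) / u) = sine_int p M - sine_int p e.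
Proof.
move=> e0 eM; rewrite /sine_int.
rewrite (@Rintegral_itvB _ _ (BRight 0) (BRight M) e) ?bnd_simp//; last 2 first.
- apply: (@bounded_integrable _ _ _ _ _ _ `|p|) => //; first exact: lebesgue_itv_lty.
    by apply: measurable_funTS; exact: measurable_sine_quot.
  by move=> u _; exact: sine_quot_bound.
- exact: ltW.
rewrite Rintegral_itv_obnd_cbnd//.
apply: (@bounded_integrable _ _ _ _ _ _ `|p|) => //; first exact: lebesgue_itv_lty.
  by apply: measurable_funTS; exact: measurable_sine_quot.
by move=> u _; exact: sine_quot_bound.
Qed.

(** Unlike the sine integral it diverges logarithmically as [e] tends to [0], so only differences in
    the upper limit are estimated. *)
Definition cosine_int (p e M : R) : R := \int[mu]_(u in `[e, M]) (cos (u * p) / u).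

Lemma measurable_cosine_quot (p : R) : measurable_fun [set: R] (fun u => cos (u * p) / u).
Proof.
apply: measurable_funM; last exact: measurable_invr.
by apply: measurableT_comp; [exact: measurable_cos|exact: measurable_funM].
Qed.

Let cosine_quot_bound (p e u : R) : 0 < e -> e <= u -> `|cos (u * p) / u| <= e^-1.
Proof.
move=> e0 eu; have u0 := lt_le_trans e0 eu.
rewrite normrM normfV (gtr0_norm u0) -[leRHS]mul1r; apply: ler_pM => //.
- by rewrite invr_ge0 ltW.
- exact: cos_max.
- by rewrite lef_pV2.
Qed.

Let integrable_cosine_quot (p e M : R) : 0 < e ->
  mu.-integrable `[e, M] (EFin \o (fun u => cos (u * p) / u)).
Proof.
move=> e0; apply: (@bounded_integrable _ _ _ _ _ _ e^-1) => //; first exact: lebesgue_itv_lty.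
  by apply: measurable_funTS; exact: measurable_cosine_quot.
by move=> u; rewrite /= in_itv /= => /andP[eu _]; exact: cosine_quot_bound.
Qed.

Let integrable_sine_quot (p e M : R) :
  mu.-integrable `[e, M] (EFin \o (fun u => sin (u * p) / u)).
Proof.
apply: (@bounded_integrable _ _ _ _ _ _ `|p|) => //; first exact: lebesgue_itv_lty.
  by apply: measurable_funTS; exact: measurable_sine_quot.
by move=> u _; exact: sine_quot_bound.
Qed.

Lemma cosine_int_sub (p e M M' : R) : 0 < e -> e <= M -> M <= M' ->
  `|cosine_int p e M' - cosine_int p e M| <= (M' - M) / M.
Proof.
move=> e0 eM MM'; have M0 := lt_le_trans e0 eM; rewrite /cosine_int.
rewrite (@Rintegral_itvB _ _ (BLeft e) (BRight M') M) ?bnd_simp//; last first.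
  exact: integrable_cosine_quot.
rewrite mulrC; apply: bounded_Rintegral_itv => //.
  exact: measurable_cosine_quot.
by move=> u /=; rewrite in_itv /= => /andP[/ltW Mu _]; exact: cosine_quot_bound.
Qed.

(** The two upper limits are [2 |x|] apart, and [1 / u] is at most [1 / (N - |x|)] between them; the
    sign of [x] only decides which limit is the larger. *)
Lemma cosine_int_dist (p e x N : R) : 0 < e -> e + `|x| <= N ->
  `|cosine_int p e (N + x) - cosine_int p e (N - x)| <= 2 * `|x| / (N - `|x|).
Proof.
move=> e0 eN.
have [x0|/ltW x0] := leP 0 x.
  move: eN; rewrite ger0_norm// => eN.
  have := @cosine_int_sub p e (N - x) (N + x) e0.
  have -> : N + x - (N - x) = 2 * x by ring.
  by apply; lra.
move: eN; rewrite ler0_norm// => eN; rewrite distrC.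
have := @cosine_int_sub p e (N + x) (N - x) e0.
have -> : N - x - (N + x) = 2 * - x by ring.
by rewrite opprK; apply; lra.
Qed.

Lemma Rintegral_reflect (x a b : R) (G : R -> R) : a <= b ->
  {within `[x - b, x - a], continuous G} ->
  \int[mu]_(s in `[x - b, x - a]) G s = \int[mu]_(u in `[a, b]) G (x - u).
Proof.
move=> ab cG; rewrite /Rintegral; congr fine.
have dF (u : R) : is_derive u 1 (fun u : R => x - u) (- 1).
  apply: (is_derive_eq (is_deriveD (is_derive_cst x u 1) (is_deriveN (is_derive_id u 1)))).
  by rewrite add0r.
have F' : (fun u : R => x - u)^`()%classic = cst (-1).
  by apply/funext => u; rewrite derive1E; exact: derive_val.
have cF : continuous (fun u : R => x - u).
  by move=> u; apply/differentiable_continuous/derivable1_diffP; exact: ex_derive.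
rewrite (@integration_by_substitution_decreasing _ (fun u => x - u))// ?F'.
- by apply: eq_integral => u _; rewrite /= !fctE opprK mulr1.
- by move=> u v _ _ uv; rewrite ltrD2l ltrN2.
- by move=> ? _; exact: cvg_cst.
- exact: is_cvg_cst.
- exact: is_cvg_cst.
- split.
  + by move=> u _; exact: ex_derive.
  + by apply: cvg_at_right_filter; exact: cF.
  + by apply: cvg_at_left_filter; exact: cF.
Qed.

Lemma Rintegral_translate (x a b : R) (G : R -> R) : a <= b ->
  {within `[x + a, x + b], continuous G} ->
  \int[mu]_(s in `[x + a, x + b]) G s = \int[mu]_(u in `[a, b]) G (x + u).
Proof.
move=> ab cG; rewrite /Rintegral; congr fine.
have dF (u : R) : is_derive u 1 (fun u : R => x + u) 1.
  apply: (is_derive_eq (is_deriveD (is_derive_cst x u 1) (is_derive_id u 1))).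
  by rewrite add0r.
have F' : (fun u : R => x + u)^`()%classic = cst 1.
  by apply/funext => u; rewrite derive1E; exact: derive_val.
have cF : continuous (fun u : R => x + u).
  by move=> u; apply/differentiable_continuous/derivable1_diffP; exact: ex_derive.
rewrite (@integration_by_substitution_increasing _ (fun u => x + u))// ?F'.
- by apply: eq_integral => u _; rewrite /= !fctE mulr1.
- by move=> u v _ _ uv; rewrite ltrD2l.
- by move=> ? _; exact: cvg_cst.
- exact: is_cvg_cst.
- exact: is_cvg_cst.
- split.
  + by move=> u _; exact: ex_derive.
  + by apply: cvg_at_right_filter; exact: cF.
  + by apply: cvg_at_left_filter; exact: cF.
Qed.

Definition hkernel (x : R) (f : R -> R) (e N : R) : R :=
  \int[mu]_(s in `[- N, x - e]) (f s / (x - s)) + \int[mu]_(s in `[x + e, N]) (f s / (x - s)).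

Let continuous_quot (x p th s : R) : s != x ->
  {for s, continuous (fun s : R => cos (s * p - th) / (x - s))}.
Proof.
move=> sx; apply: cvgM.
  apply: (@continuous_comp _ _ _ (fun s : R => s * p - th)); last exact: continuous_cos.
  by apply: cvgB; [apply: cvgMr_tmp; exact: cvg_id|exact: cvg_cst].
apply: cvgV; first by rewrite subr_eq0 eq_sym.
by apply: cvgB; [exact: cvg_cst|exact: cvg_id].
Qed.

(* Substitute [s = x - u] and [s = x + u]: the cosine parts of the two integrals cancel up to the
   asymmetry of [-N, N] around [x]. *)
Lemma hkernel_cos (x p th e N : R) : 0 < e -> e + `|x| <= N ->
  hkernel x (fun s => cos (s * p - th)) e N =
  sin (x * p - th) * (sine_int p (N + x) + sine_int p (N - x) - 2 * sine_int p e) +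
  cos (x * p - th) * (cosine_int p e (N + x) - cosine_int p e (N - x)).
Proof.
move=> e0 eN; have [eN1 eN2] : e <= N + x /\ e <= N - x.
  by have := ler_norm x; have := ler_norm (- x); rewrite normrN; split; lra.
rewrite /hkernel.
have -> : - N = x - (N + x) by ring.
rewrite Rintegral_reflect//; last first.
  apply: continuous_in_subspaceT => s; rewrite inE /= in_itv /= => /andP[_ sx].
  by apply: continuous_quot; rewrite lt_eqF//; lra.
have hN : x + (N - x) = N by ring.
rewrite -[in X in _ + X = _]hN Rintegral_translate//; last first.
  apply: continuous_in_subspaceT => s; rewrite inE /= in_itv /= => /andP[sx _].
  by apply: continuous_quot; rewrite gt_eqF//; lra.
set a := x * p - th.
have -> : \int[mu]_(u in `[e, N + x]) (cos ((x - u) * p - th) / (x - (x - u))) =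
    cos a * cosine_int p e (N + x) + sin a * (sine_int p (N + x) - sine_int p e).
  rewrite -sine_int_sub// /cosine_int.
  rewrite -(@RintegralZl _ _ _ mu _ (fun u => cos (u * p) / u) (cos a))//; last first.
    exact: integrable_cosine_quot.
  rewrite -(@RintegralZl _ _ _ mu _ (fun u => sin (u * p) / u) (sin a))//.
  rewrite -RintegralD//; last 2 first.
  - by apply: integrable_scalel => //; exact: integrable_cosine_quot.
  - by apply: integrable_scalel => //; exact: integrable_sine_quot.
  apply: eq_Rintegral => u _.
  have -> : (x - u) * p - th = a - u * p by rewrite /a; ring.
  have -> : x - (x - u) = u by ring.
  by rewrite cosB; ring.
have -> : \int[mu]_(u in `[e, N - x]) (cos ((x + u) * p - th) / (x - (x + u))) =
    - cos a * cosine_int p e (N - x) + sin a * (sine_int p (N - x) - sine_int p e).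
  rewrite -sine_int_sub// /cosine_int.
  rewrite -(@RintegralZl _ _ _ mu _ (fun u => cos (u * p) / u) (- cos a))//; last first.
    exact: integrable_cosine_quot.
  rewrite -(@RintegralZl _ _ _ mu _ (fun u => sin (u * p) / u) (sin a))//.
  rewrite -RintegralD//; last 2 first.
  - by apply: integrable_scalel => //; exact: integrable_cosine_quot.
  - by apply: integrable_scalel => //; exact: integrable_sine_quot.
  apply: eq_Rintegral => u _.
  have -> : (x + u) * p - th = a + u * p by rewrite /a; ring.
  have -> : x - (x + u) = - u by ring.
  by rewrite cosD invrN; ring.
by ring.
Qed.

(** Sine integrals enter with total weight [4], each at most [pi / 2 + 2]. The condition
    [e + 3 |x| <= N] makes [2 |x| <= N - |x|], so the cosine remainder is at most [1]. *)
Lemma hkernel_cos_bound (x p th e N : R) : 0 < e -> e + 3 * `|x| <= N ->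
  `|hkernel x (fun s => cos (s * p - th)) e N| <= 4 * (pi / 2 + 2) + 1.
Proof.
move=> e0 eN3; have x0 := normr_ge0 x; have eN : e + `|x| <= N by lra.
have [eN1 eN2] : e <= N + x /\ e <= N - x.
  by have := ler_norm x; have := ler_norm (- x); rewrite normrN; split; lra.
rewrite hkernel_cos//; apply: le_trans (ler_normD _ _) _; apply: lerD.
  rewrite normrM; apply: le_trans (ler_piMl (normr_ge0 _) (sin_max _)) _.
  apply: le_trans (ler_normB _ _) _; rewrite normrM ger0_norm//.
  have := ler_normD (sine_int p (N + x)) (sine_int p (N - x)).
  have := sine_int_bound p e0.
  have := sine_int_bound p (lt_le_trans e0 eN1).
  have := sine_int_bound p (lt_le_trans e0 eN2).
  by lra.
rewrite normrM; apply: le_trans (ler_piMl (normr_ge0 _) (cos_max _)) _.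
apply: le_trans (cosine_int_dist _ _ _) _ => //.
by rewrite ler_pdivrMr; lra.
Qed.

(** Pointwise in [p], not uniform: the rate degenerates both for small and for large [|p|]. At
    [p = 0] the term [4 / |p|] is [0] by the convention for division, which is right because the
    sine integrals vanish there. *)
Lemma hkernel_cos_dist (x p th e N : R) : 0 < e -> e + `|x| <= N ->
  `|hkernel x (fun s => cos (s * p - th)) e N - pi * (Num.sg p * sin (x * p - th))| <=
  4 / `|p| / (N - `|x|) + 2 * `|p| * e + 2 * `|x| / (N - `|x|).
Proof.
move=> e0 eN; have x0 := normr_ge0 x.
have [eN1 eN2] : N - `|x| <= N + x /\ N - `|x| <= N - x.
  by have := ler_norm x; have := ler_norm (- x); rewrite normrN; split; lra.
have K0 : 0 < N - `|x| by lra.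
rewrite hkernel_cos//.
(* [c] is the limit of each of the sine integrals up to [N + x] and [N - x], and
   [2 c = pi sgn p]. *)
set a := x * p - th; set c := Num.sg p * (pi / 2).
have -> : sin a * (sine_int p (N + x) + sine_int p (N - x) - 2 * sine_int p e) +
    cos a * (cosine_int p e (N + x) - cosine_int p e (N - x)) - pi * (Num.sg p * sin a) =
  sin a * ((sine_int p (N + x) - c) + (sine_int p (N - x) - c) - 2 * sine_int p e) +
    cos a * (cosine_int p e (N + x) - cosine_int p e (N - x)).
  by rewrite /c; field.
have H M : N - `|x| <= M -> `|sine_int p M - c| <= 2 / `|p| / (N - `|x|).
  move=> NM; apply: le_trans (sine_int_sg _ (lt_le_trans K0 NM)) _.
  rewrite invfM mulrA mulrAC ler_wpM2l ?mulr_ge0 ?invr_ge0//.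
  by rewrite lef_pV2// posrE// (lt_le_trans K0).
apply: le_trans (ler_normD _ _) _; apply: lerD.
  rewrite normrM; apply: le_trans (ler_piMl (normr_ge0 _) (sin_max _)) _.
  apply: le_trans (ler_normB _ _) _; rewrite normrM ger0_norm//.
  have := ler_normD (sine_int p (N + x) - c) (sine_int p (N - x) - c).
  have := sine_int_le p (ltW e0).
  have := H _ eN1; have := H _ eN2.
  have -> : 4 / `|p| / (N - `|x|) = 2 / `|p| / (N - `|x|) + 2 / `|p| / (N - `|x|).
    by rewrite -!mulrDl; congr (_ / _ / _); ring.
  by move: (2 / _ / _) => t; lra.
rewrite normrM; apply: le_trans (ler_piMl (normr_ge0 _) (cos_max _)) _.
exact: cosine_int_dist.
Qed.

End Kernel.

(** * Hilbert transforms of real superpositions of waves *)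

Section RealHilbert.
Context {R : realType}.
Notation mu := (@lebesgue_measure R).

(** If the limit failed for some tolerance, every basic neighbourhood would contain a bad point, and
    choosing one for each [n] gives a sequence contradicting the hypothesis. The offset [C] lets a
    caller assume from the first index on that [N] is large. *)
Lemma cvg_hilbert_filter (F : R -> R -> R) (C l : R) :
  (forall e_ N_ : R^nat, (forall n, 0 < e_ n <= n.+1%:R^-1) ->
     (forall n, n.+1%:R + C <= N_ n) -> F (e_ n) (N_ n) @[n --> \oo] --> l) ->
  F p.1 p.2 @[p --> @hilbert_filter R] --> l.
Proof.
move=> H; apply/cvgrPdist_lt => eps eps0; apply: contrapT => nh.
have {}nh n : exists p : R * R, [/\ 0 < p.1 <= n.+1%:R^-1, n.+1%:R + C <= p.2 &
    eps <= `|l - F p.1 p.2|].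
  apply: contrapT => np; apply: nh.
  exists ([set e | 0 < e <= n.+1%:R^-1], [set N | n.+1%:R + C <= N]) => /=.
    split.
    - near=> e => /=; apply/andP; split; first by near: e; exact: nbhs_right_gt.
      by near: e; apply: nbhs_right_le; rewrite invr_gt0.
    - by near=> N => /=; near: N; apply: nbhs_pinfty_ge; exact: num_real.
  move=> [e N] /= [eP NP]; rewrite ltNge; apply/negP => h; apply: np.
  by exists (e, N).
have [p hp] := choice nh.
have := H (fst \o p) (snd \o p).
move=> /(_ (fun n => let: And3 h _ _ := hp n in h) (fun n => let: And3 _ h _ := hp n in h)).
move/cvgrPdist_lt => /(_ _ eps0) [n _ /(_ n (leqnn n))] /=.
by have [_ _] := hp n; rewrite leNgt => /negP.
Unshelve. all: by end_near. Qed.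

(** [l] is the value of the transform itself; [hkernel] omits the factor [1 / pi], which therefore
    reappears as [pi] in the limit. *)
Definition has_hilbert (f : R -> R) (x l : R) : Prop :=
  (forall e N : R, 0 < e ->
     mu.-integrable `[- N, x - e] (fun s => (f s / (x - s))%:E) /\
     mu.-integrable `[x + e, N] (fun s => (f s / (x - s))%:E)) /\
  hkernel x f p.1 p.2 @[p --> @hilbert_filter R] --> pi * l.

Section Wave.
Context d (T : measurableType d) (m : {finite_measure set T -> \bar R}).
Variables (phi : T -> R) (th x : R).
Hypothesis mphi : measurable_fun [set: T] phi.

(** With [th = 0] the integrand is [cos (s phi)], with [th = - pi / 2] it is [- sin (s phi)]. *)
Definition wave (s : R) : R := \int[m]_t cos (s * phi t - th).

Let k (z : R * T) : R := cos (z.1 * phi z.2 - th) / (x - z.1).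

Let mk : measurable_fun [set: measurableTypeR R * T] k.
Proof.
apply: measurable_funM.
  apply: measurableT_comp; first exact: measurable_cos.
  apply: measurable_funB => //; apply: measurable_funM; first exact: measurable_fst.
  exact: (measurableT_comp mphi measurable_snd).
apply: (measurableT_comp measurable_invr).
by apply: measurable_funB => //; exact: measurable_fst.
Qed.

Let mcos (s : R) : measurable_fun [set: T] (fun t => cos (s * phi t - th)).
Proof.
apply: measurableT_comp; first exact: measurable_cos.
by apply: measurable_funB => //; exact: measurable_funM.
Qed.

Let mT : (m [set: T] < +oo)%E.
Proof. by rewrite -ge0_fin_numE// fin_num_measure. Qed.

Let icos (s : R) : m.-integrable [set: T] (EFin \o (fun t => cos (s * phi t - th))).
Proof. by apply: (@bounded_integrable _ _ _ _ _ _ 1) => // t _; exact: cos_max. Qed.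

Section On.
Variables (D : set R) (e : R).
Hypotheses (mD : measurable (D : set (measurableTypeR R))) (Dfin : (mu D < +oo)%E).
Hypotheses (e0 : 0 < e) (De : forall s, D s -> e <= `|x - s|).

Let k_bound s t : D s -> `|k (s, t)| <= e^-1.
Proof.
move=> /De xs; rewrite /k /= normrM -[leRHS]mul1r; apply: ler_pM => //.
  exact: cos_max.
by rewrite normfV lef_pV2// posrE (lt_le_trans e0).
Qed.

Let ig : mu.-integrable D (EFin \o cst (e^-1 * fine (m setT))).
Proof.
apply: (@bounded_integrable _ _ _ _ _ _ `|e^-1 * fine (m setT)|) => //.
Qed.

Let fg s : D s -> (\int[m]_(t in setT) `|k (s, t)|%:E <= (e^-1 * fine (m setT))%:E)%E.
Proof.
move=> Ds; apply: (@le_trans _ _ (\int[m]_(t in setT) (e^-1)%:E)%E).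
  apply: ge0_le_integral => //.
  - by apply/measurable_EFinP; apply: measurableT_comp => //; exact: (measurableT_comp mk (measurable_pair1 s)).
  - by move=> t _; rewrite lee_fin k_bound.
by rewrite integral_cst// EFinM fineK// fin_num_measure.
Qed.

Let wave_quot s : (\int[m]_t (k (s, t))%:E)%E = (wave s / (x - s))%:E.
Proof.
rewrite /wave -RintegralZr// /Rintegral fineK//.
apply: integrable_fin_num => //.
have := integrable_scalel (x - s)^-1 measurableT (icos s).
by apply: eq_integrable => // t _; rewrite /= mulrC.
Qed.

Lemma integrable_wave : mu.-integrable D (fun s => (wave s / (x - s))%:E).
Proof.
have := @Fubini_on_integrable1 R _ _ _ _ mu m D setT mD measurableT k _ mk ig fg.
by apply: eq_integrable => // s _; rewrite wave_quot.
Qed.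

Let cos_quot_bounded t s : D s -> `|cos (s * phi t - th) / (x - s)| <= e^-1.
Proof. exact: k_bound. Qed.

Let integrable_cos_quot t : mu.-integrable D (EFin \o (fun s => cos (s * phi t - th) / (x - s))).
Proof.
apply: (@bounded_integrable _ _ _ _ _ _ e^-1) => //; last exact: cos_quot_bounded.
by apply: measurable_funTS; exact: (measurableT_comp mk (measurable_pair2 t)).
Qed.

Let inner t : (\int[mu]_(s in D) (k (s, t))%:E)%E =
  (\int[mu]_(s in D) (cos (s * phi t - th) / (x - s)))%:E.
Proof.
rewrite /Rintegral fineK//.
by have := integrable_fin_num mD (integrable_cos_quot t).
Qed.

Lemma measurable_cos_quot_integral : measurable_fun [set: T]
  (fun t => \int[mu]_(s in D) (cos (s * phi t - th) / (x - s))).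
Proof.
have := @Fubini_on_measurable2 R _ _ _ _ mu m D setT mD measurableT k _ mk ig fg.
move=> H; apply/measurable_EFinP; move: H; apply: eq_measurable_fun => t _.
by rewrite inner.
Qed.

Lemma cos_quot_integral_bound t :
  `|\int[mu]_(s in D) (cos (s * phi t - th) / (x - s))| <= e^-1 * fine (mu D).
Proof.
apply: bounded_Rintegral => //; last exact: cos_quot_bounded.
by apply: measurable_funTS; exact: (measurableT_comp mk (measurable_pair2 t)).
Qed.

(** [D] stays at distance [e] from the singularity and has finite length, so the kernel is bounded
    by [1 / e] and Fubini applies against the finite measure [m]. *)
Lemma Rintegral_wave : \int[mu]_(s in D) (wave s / (x - s)) =
  \int[m]_t \int[mu]_(s in D) (cos (s * phi t - th) / (x - s)).
Proof.
have := @Fubini_on R _ _ _ _ mu m D setT mD measurableT k _ mk ig fg.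
rewrite /Rintegral => H; congr fine.
under [RHS]eq_integral => t _ do rewrite -/(Rintegral mu D _) -inner.
by rewrite -H; apply: eq_integral => s _; rewrite wave_quot.
Qed.

End On.

Let itv_left (e N s : R) : 0 < e -> s \in `[- N, x - e] -> e <= `|x - s|.
Proof.
by move=> e0; rewrite in_itv /= => /andP[_ h]; rewrite ger0_norm; lra.
Qed.

Let itv_right (e N s : R) : 0 < e -> s \in `[x + e, N] -> e <= `|x - s|.
Proof.
by move=> e0; rewrite in_itv /= => /andP[h _]; rewrite ler0_norm; lra.
Qed.

Let hk (e N : R) (t : T) : R := hkernel x (fun s => cos (s * phi t - th)) e N.

Let integrable_piece (D : set R) (e : R) : measurable (D : set (measurableTypeR R)) ->
  (mu D < +oo)%E -> 0 < e -> (forall s, D s -> e <= `|x - s|) ->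
  m.-integrable [set: T]
    (EFin \o (fun t => \int[mu]_(s in D) (cos (s * phi t - th) / (x - s)))).
Proof.
move=> mD Dfin e0 De.
apply: (@bounded_integrable _ _ _ _ _ _ (e^-1 * fine (mu D))) => //.
  exact: (measurable_cos_quot_integral mD Dfin e0 De).
by move=> t _; exact: (cos_quot_integral_bound mD Dfin e0 De).
Qed.

Let hkernel_wave (e N : R) : 0 < e ->
  hkernel x wave e N = \int[m]_t hk e N t.
Proof.
move=> e0; rewrite /hkernel.
rewrite (@Rintegral_wave _ e)//; [|exact: lebesgue_itv_lty|by move=> s; exact: itv_left].
rewrite (@Rintegral_wave _ e)//; [|exact: lebesgue_itv_lty|by move=> s; exact: itv_right].
rewrite -RintegralD//.
- by apply: (@integrable_piece _ e) => //; [exact: lebesgue_itv_lty|move=> s; exact: itv_left].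
- by apply: (@integrable_piece _ e) => //; [exact: lebesgue_itv_lty|move=> s; exact: itv_right].
Qed.

Let measurable_hk (e N : R) : 0 < e -> measurable_fun [set: T] (hk e N).
Proof.
move=> e0; apply: measurable_funD.
- apply: (@measurable_cos_quot_integral _ e) => //; [exact: lebesgue_itv_lty|by move=> s; exact: itv_left].
- apply: (@measurable_cos_quot_integral _ e) => //; [exact: lebesgue_itv_lty|by move=> s; exact: itv_right].
Qed.

Lemma has_hilbert_wave :
  has_hilbert wave x (\int[m]_t (Num.sg (phi t) * sin (x * phi t - th))).
Proof.
have x0 := normr_ge0 x.
split=> [e N e0|].
  split; apply: (@integrable_wave _ e) => //.
  - exact: lebesgue_itv_lty.
  - by move=> s; exact: itv_left.
  - exact: lebesgue_itv_lty.
  - by move=> s; exact: itv_right.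
(* Since [e <= 1 / (n + 1) <= 1], this offset guarantees [e + 3 |x| <= N], the hypothesis of the
   uniform bound, and [N - |x| >= n + 1], which gives the rate. *)
apply: (@cvg_hilbert_filter _ (1 + 3 * `|x|)) => e_ N_ he hN.
have e0 n : 0 < e_ n by case/andP: (he n).
have e1 n : e_ n <= n.+1%:R^-1 by case/andP: (he n).
have n1 (n : nat) : 1 <= n.+1%:R :> R by rewrite ler1n.
have V1 (n : nat) : n.+1%:R^-1 <= 1 :> R by rewrite invf_le1// ltr0n.
have eN n : e_ n + 3 * `|x| <= N_ n.
  have := hN n; have := e1 n; have := n1 n; have := V1 n.
  by move: (n.+1%:R^-1 : R) (n.+1%:R : R) => v w; lra.
have eN' n : e_ n + `|x| <= N_ n by have := eN n; lra.
have Nn n : n.+1%:R <= N_ n - `|x|.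
  by have := hN n; move: (n.+1%:R : R) => w; lra.
pose L t : R := pi * (Num.sg (phi t) * sin (x * phi t - th)).
have hkL t : hk (e_ n) (N_ n) t @[n --> \oo] --> L t.
  (* The three coefficients of the error bound; their factors [1 / (N - |x|)] and [e] are all at
     most [1 / (n + 1)]. As [c] depends on [t], convergence is only pointwise, and the uniform bound
     has to supply the domination. *)
  pose c : R := 4 / `|phi t| + 2 * `|phi t| + 2 * `|x|.
  have cvgc : c / n.+1%:R @[n --> \oo] --> (0 : R).
    by rewrite -(mulr0 c); apply: cvgMl_tmp; exact: cvg_harmonic.
  apply/cvgrPdist_le => eps eps0.
  move/cvgrPdist_le : cvgc => /(_ _ eps0); apply: filterS => n.
  rewrite sub0r normrN => h; rewrite distrC.
  apply: le_trans (hkernel_cos_dist _ _ (e0 n) (eN' n)) _.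
  apply: le_trans (le_trans (ler_norm _) h).
  rewrite /c; have : 0 <= 4 / `|phi t| by rewrite mulr_ge0 ?invr_ge0.
  have : 0 <= 2 * `|phi t| by rewrite mulr_ge0.
  have : 0 <= 2 * `|x| by rewrite mulr_ge0.
  move: (4 / _) (2 * `|phi t|) (2 * `|x|) => c1 c2 c3 c30 c20 c10.
  rewrite 2!mulrDl; apply: lerD; first apply: lerD.
  - by rewrite ler_wpM2l// lef_pV2 ?posrE ?(lt_le_trans _ (Nn n)) ?ltr0n.
  - by rewrite ler_wpM2l.
  - by rewrite ler_wpM2l// lef_pV2 ?posrE ?(lt_le_trans _ (Nn n)) ?ltr0n.
have mhk n : measurable_fun setT (hk (e_ n) (N_ n)) by exact: measurable_hk.
have mL : measurable_fun setT L.
  (* [L] inherits measurability as a pointwise limit of the truncations. *)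
  have H : measurable_fun [set: T] (EFin \o L).
    apply: (@emeasurable_fun_cvg _ _ _ _ (fun n => EFin \o hk (e_ n) (N_ n))).
      by move=> n; apply/measurable_EFinP.
    by move=> t _; apply: cvg_EFin; [exact: nearW|exact: hkL].
  exact/measurable_EFinP.
have hkb n t : `|hk (e_ n) (N_ n) t| <= 4 * (pi / 2 + 2) + 1 by exact: hkernel_cos_bound.
have Lb t : `|L t| <= pi.
  rewrite /L normrM (ger0_norm (pi_ge0 R)) ler_piMr ?pi_ge0// normrM mulr_ile1//.
    by rewrite normr_sg; case: (phi t != 0).
  exact: sin_max.
have iL : m.-integrable setT (EFin \o L).
  by apply: (@bounded_integrable _ _ _ _ _ _ pi) => // t _; exact: Lb.
have isg : m.-integrable setT (EFin \o (fun t => Num.sg (phi t) * sin (x * phi t - th))).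
  have := integrable_scalel pi^-1 measurableT iL.
  by apply: eq_integrable => // t _; rewrite /= /L mulrA mulVf ?mul1r// gt_eqF ?pi_gt0.
rewrite -RintegralZl//.
under eq_cvg => n do rewrite hkernel_wave//.
apply: fine_cvg; rewrite fineK; last by apply: integrable_fin_num.
have h1 n : measurable_fun [set: T] (EFin \o hk (e_ n) (N_ n)) by exact/measurable_EFinP.
have h2 : measurable_fun [set: T] (EFin \o L) by exact/measurable_EFinP.
have h3 : {ae m, forall t, [set: T] t -> (EFin \o hk (e_ n) (N_ n)) t @[n --> \oo] --> (EFin \o L) t}.
  by apply: aeW => t _; apply: cvg_EFin; [exact: nearW|exact: hkL].
have h4 := finite_measure_integrable_cst m (4 * (pi / 2 + 2) + 1) measurableT.
have h5 : {ae m, forall t n, [set: T] t ->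
    (`|(EFin \o hk (e_ n) (N_ n)) t| <= (EFin \o cst (4 * (pi / 2 + 2) + 1)%R) t)%E}.
  by apply: aeW => t n _; rewrite lee_fin.
by have [_ _] := dominated_convergence measurableT h1 h2 h3 h4 h5.
Qed.

End Wave.

Lemma has_hilbert_lin (f g : R -> R) (x a b lf lg : R) :
  has_hilbert f x lf -> has_hilbert g x lg ->
  has_hilbert (fun s => a * f s + b * g s) x (a * lf + b * lg).
Proof.
move=> [fi fl] [gi gl].
have lin (D : set R) : measurable (D : set (measurableTypeR R)) ->
    mu.-integrable D (fun s => (f s / (x - s))%:E) ->
    mu.-integrable D (fun s => (g s / (x - s))%:E) ->
    mu.-integrable D (fun s => ((a * f s + b * g s) / (x - s))%:E) /\
    \int[mu]_(s in D) ((a * f s + b * g s) / (x - s)) =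
    a * \int[mu]_(s in D) (f s / (x - s)) + b * \int[mu]_(s in D) (g s / (x - s)).
  move=> mD iF iG.
  have iF' := integrable_scalel a mD iF; have iG' := integrable_scalel b mD iG.
  split.
    have := integrableD mD iF' iG'; apply: eq_integrable => // s _.
    by rewrite /= -EFinD mulrDl !mulrA.
  rewrite -!RintegralZl// -RintegralD//.
  by apply: eq_Rintegral => s _; rewrite mulrDl !mulrA.
split=> [e N e0|].
  have [f1 f2] := fi e N e0; have [g1 g2] := gi e N e0.
  by split; apply: (lin _ _ _ _).1.
have -> : pi * (a * lf + b * lg) = a * (pi * lf) + b * (pi * lg) by ring.
have : (fun p : R * R => a * hkernel x f p.1 p.2 + b * hkernel x g p.1 p.2)
    @ @hilbert_filter R --> a * (pi * lf) + b * (pi * lg).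
  by apply: cvgD; apply: cvgMl_tmp.
apply: cvg_trans; apply: near_eq_cvg.
(* Splitting the integrals needs integrability, which is assumed for [e > 0] only, so the two sides
   agree eventually along the filter rather than everywhere. *)
exists ([set e | 0 < e], setT).
  by split => /=; [exact: nbhs_right_gt|exact: filterT].
move=> [e N] /= [e0 _]; rewrite /hkernel.
have [f1 f2] := fi e N e0; have [g1 g2] := gi e N e0.
rewrite (lin _ _ f1 g1).2// (lin _ _ f2 g2).2//.
by ring.
Qed.

#[global] Instance hilbert_filter_proper : ProperFilter (@hilbert_filter R).
Proof. exact: filter_prod_proper. Qed.

Lemma has_hilbert_unique (f : R -> R) (x l l' : R) :
  has_hilbert f x l -> has_hilbert f x l' -> l = l'.
Proof.
move=> [_ h] [_ h']; have pi0 : (pi : R) != 0 by rewrite gt_eqF// pi_gt0.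
exact: (mulfI pi0 (cvg_unique (@Rhausdorff R) h h')).
Qed.

End RealHilbert.

(** * Uniqueness of measures with equal cosine and sine transforms *)

Section FiniteMeasureContinuity.
Context {R : realType} d (T : measurableType d) (m : {finite_measure set T -> \bar R}).

Lemma fine_nondecreasing_cvg (F : (set T)^nat) (A : set T) :
  (forall i, measurable (F i)) -> measurable A -> A = \bigcup_n F n ->
  nondecreasing_seq F -> fine (m (F n)) @[n --> \oo] --> fine (m A).
Proof.
move=> mF mA AE ndF; have := nondecreasing_cvg_mu mF _ ndF; rewrite -AE => /(_ _ m mA) h.
by apply: fine_cvg; rewrite fineK ?fin_num_measure.
Qed.

Lemma fine_nonincreasing_cvg (F : (set T)^nat) (A : set T) :
  (forall i, measurable (F i)) -> measurable A -> A = \bigcap_n F n ->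
  nonincreasing_seq F -> fine (m (F n)) @[n --> \oo] --> fine (m A).
Proof.
move=> mF mA AE niF.
have m0 : (m (F 0%N) < +oo)%E by rewrite -ge0_fin_numE// fin_num_measure.
have := nonincreasing_cvg_mu m0 mF _ niF; rewrite -AE => /(_ mA) h.
by apply: fine_cvg; rewrite fineK ?fin_num_measure.
Qed.

End FiniteMeasureContinuity.

Section Uniqueness.
Context {R : realType}.
Notation T := (measurableTypeR R).
Implicit Type m : {finite_measure set T -> \bar R}.

Section Balanced.
Variables m1 m2 : {finite_measure set T -> \bar R}.
Let D (A : set T) : R := fine (m1 A) - fine (m2 A).
Hypothesis balanced : forall a : R, D `]a, +oo[ = D `]-oo, a[.

Let D_nd (F : (set T)^nat) (A : set T) :
  (forall i, measurable (F i)) -> measurable A -> A = \bigcup_n F n ->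
  nondecreasing_seq F -> D (F n) @[n --> \oo] --> D A.
Proof. by move=> *; apply: cvgB; exact: fine_nondecreasing_cvg. Qed.

Let D_ni (F : (set T)^nat) (A : set T) :
  (forall i, measurable (F i)) -> measurable A -> A = \bigcap_n F n ->
  nonincreasing_seq F -> D (F n) @[n --> \oo] --> D A.
Proof. by move=> *; apply: cvgB; exact: fine_nonincreasing_cvg. Qed.

Let archi (x : R) : exists n : nat, x < n%:R.
Proof. by exists (Num.truncn x).+1; exact: truncnS_gt. Qed.

Let archiV (x : R) : 0 < x -> exists n : nat, n.+1%:R^-1 < x.
Proof.
move=> x0; have [n xn] := archi x^-1; exists n.
by rewrite -[ltRHS]invrK ltf_pV2 ?posrE ?invr_gt0// (lt_trans xn)// ltr_nat.
Qed.

(** Let [a] tend to infinity in the balance condition: the right rays shrink to the empty set while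
    the left rays fill the line. *)
Let DT : D setT = 0.
Proof.
have h1 : D `]-oo, n%:R[ @[n --> \oo] --> D setT.
  apply: (@D_nd (fun n : nat => `]-oo, n%:R[%classic)) => //.
    apply/seteqP; split => // x _; have [n xn] := archi x; exists n => //; rewrite /= in_itv.
  move=> i j ij; apply/subsetPset => x /=; rewrite !in_itv/= => /lt_le_trans; apply.
  by rewrite ler_nat.
have h2 : D `]n%:R, +oo[ @[n --> \oo] --> D set0.
  apply: (@D_ni (fun n : nat => `]n%:R, +oo[%classic)) => //.
    apply/esym/seteqP; split => // x h; have [n xn] := archi x.
    by have := h n Logic.I; rewrite /= in_itv /= andbT ltNge ltW.
  move=> i j ij; apply/subsetPset => x /=; rewrite !in_itv/= !andbT.
  by apply: le_lt_trans; rewrite ler_nat.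
have D0 : D set0 = 0 by rewrite /D !measure0 subrr.
have {}h1 : D `]n%:R, +oo[ @[n --> \oo] --> D setT.
  by under eq_cvg => n do rewrite balanced.
by rewrite -D0; exact: (cvg_unique (@Rhausdorff R) h1 h2).
Qed.

Let D_setC (a : R) : D `]a, +oo[ + D `]-oo, a] = 0.
Proof.
have split_T (m : {finite_measure set T -> \bar R}) :
    fine (m `]a, +oo[%classic) + fine (m `]-oo, a]%classic) = fine (m setT).
  rewrite -fineD ?fin_num_measure// -measureU//; last first.
    by apply/seteqP; split => // x [] /=; rewrite !in_itv /= andbT ltNge => /negbTE ->.
  congr (fine (m _)); apply/seteqP; split => // x _ /=.
  by rewrite !in_itv /= andbT; case: (leP x a); [right|left].
by have := DT; rewrite /D -!split_T => h; lra.
Qed.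

(** Balance at points decreasing to [a] moves the endpoint into the left ray: in the limit [D]
    agrees on []a, +oo[] and []-oo, a]]. These two sets are complementary, so their values also sum
    to [D setT = 0]. *)
Let D_ray (a : R) : D `]a, +oo[ = 0.
Proof.
pose u (n : nat) : R := a + n.+1%:R^-1.
have uu i j : (i <= j)%N -> u j <= u i.
  by move=> ij; rewrite lerD2l lef_pV2 ?posrE// ler_nat ltnS.
have h1 : D `]u n, +oo[ @[n --> \oo] --> D `]a, +oo[.
  apply: (@D_nd (fun n : nat => `]u n, +oo[%classic)) => //.
    apply/seteqP; split => x /=.
      rewrite in_itv /= andbT -subr_gt0 => /archiV[n h]; exists n => //.
      by rewrite /= in_itv /= andbT /u -ltrBrDl.
    by move=> [n _] /=; rewrite !in_itv /= !andbT /u; apply: lt_trans; rewrite ltrDl invr_gt0.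
  move=> i j ij; apply/subsetPset => x /=; rewrite !in_itv/= !andbT.
  by apply: le_lt_trans; exact: uu.
have h2 : D `]-oo, u n[ @[n --> \oo] --> D `]-oo, a].
  apply: (@D_ni (fun n : nat => `]-oo, u n[%classic)) => //.
    apply/seteqP; split => x /=.
      by rewrite in_itv /= => xa n _ /=; rewrite in_itv /= /u (le_lt_trans xa)// ltrDl invr_gt0.
    move=> h; rewrite in_itv /= leNgt; apply/negP; rewrite -subr_gt0 => /archiV[n hn].
    by have := h n Logic.I; rewrite /= in_itv /= /u ltNge; move: hn; rewrite ltrBrDl => /ltW ->.
  move=> i j ij; apply/subsetPset => x /=; rewrite !in_itv/= => /lt_le_trans; apply.
  exact: uu.
have E : D `]a, +oo[ = D `]-oo, a].
  have {}h2 : D `]u n, +oo[ @[n --> \oo] --> D `]-oo, a].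
    by under eq_cvg => n do rewrite balanced.
  exact: (cvg_unique (@Rhausdorff R) h1 h2).
by have := D_setC a; rewrite -E; lra.
Qed.

Lemma balanced_measure_unique (A : set T) : measurable A -> m1 A = m2 A.
Proof.
(* Open right rays generate the Borel sets, are stable under intersection, and those starting at
   [- n] exhaust the line. *)
move=> mA; apply: (@measure_unique _ R T (@RGenOInfty.G R)
  (fun n : nat => `](- n%:R), +oo[%classic)) => //.
- exact: RGenOInfty.measurableE.
- move=> _ _ [x ->] [y ->]; exists (Num.max x y); apply/seteqP; split => z /=;
    rewrite !in_itv /= !andbT gt_max; first by move=> [-> ->].
  by move=> /andP.
- by move=> n; exists (- n%:R).
- apply/seteqP; split => // x _; have [n xn] := archi (- x); exists n => //.
  by rewrite /= in_itv /= andbT ltrNl.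
- move=> _ [x ->]; have := D_ray x.
  have fin (m : {finite_measure set T -> \bar R}) : m `]x, +oo[%classic \is a fin_num.
    by rewrite fin_num_measure.
  move=> /eqP; rewrite /D subr_eq0 => /eqP h.
  by have := congr1 EFin h; rewrite !fineK.
- by move=> n; rewrite -ge0_fin_numE// fin_num_measure.
Qed.

End Balanced.

Lemma measurable_sg : measurable_fun [set: R] (fun t : R => Num.sg t).
Proof.
have -> : (fun t : R => Num.sg t) = (fun t => (0 < t)%R%:R - (t < 0)%R%:R).
  apply/funext => t; case: (ltgtP 0 t) => [t0|t0|<-].
  - by rewrite gtr0_sg// subr0.
  - by rewrite ltr0_sg// sub0r.
  - by rewrite sgr0 subrr.
have -> : (fun t : R => (0 < t)%R%:R - (t < 0)%R%:R : R) = \1_(`]0, +oo[) \- \1_(`]-oo, 0[).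
  apply/funext => t; rewrite /= !indicE !mem_setE.
  by rewrite !in_itv /= andbT.
by apply: measurable_funB; exact: measurable_indic.
Qed.

Lemma Rintegral_sg m (a : R) :
  \int[m]_t Num.sg (t - a) = fine (m `]a, +oo[%classic) - fine (m `]-oo, a[%classic).
Proof.
have i1 (A : set T) : measurable A -> m.-integrable [set: T] (EFin \o (\1_A : T -> R)).
  move=> mA; apply: (@bounded_integrable _ _ _ _ _ _ 1) => //.
  - by rewrite -ge0_fin_numE// fin_num_measure.
  - by move=> t _; rewrite indicE; case: (t \in A); rewrite ?normr1 ?normr0.
have e1 (A : set T) : measurable A -> \int[m]_t \1_A t = fine (m A).
  by move=> mA; rewrite /Rintegral integral_indic// setIT.
rewrite -e1// -e1// -RintegralB//; [|exact: i1|exact: i1].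
apply: eq_Rintegral => t _; rewrite !indicE !mem_setE !in_itv /= andbT.
case: (ltgtP a t) => [h|h|<-].
- by rewrite gtr0_sg ?subr_gt0// subr0.
- by rewrite ltr0_sg ?subr_lt0// sub0r.
- by rewrite subrr sgr0 subrr.
Qed.

(* The transforms of the measures shifted by [a] agree as well, hence so do their Hilbert transforms
   at [0], which are the integrals of [sgn (t - a)]. *)
Lemma fourier_measure_unique (m1 m2 : {finite_measure set T -> \bar R}) :
  (forall s : R, \int[m1]_t cos (s * t) = \int[m2]_t cos (s * t)) ->
  (forall s : R, \int[m1]_t sin (s * t) = \int[m2]_t sin (s * t)) ->
  forall A, measurable A -> m1 A = m2 A.
Proof.
move=> hc hs; apply: balanced_measure_unique => a.
suff : \int[m1]_t Num.sg (t - a) = \int[m2]_t Num.sg (t - a).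
  by rewrite !Rintegral_sg => h; lra.
have mphi : measurable_fun [set: T] (fun t => t - a) by exact: measurable_funB.
(* At [x = 0] the phase [- pi / 2] turns the sine factor into [sin (pi / 2) = 1], and only
   [sgn (t - a)] is left. *)
have h m : has_hilbert (wave m (fun t => t - a) (- (pi / 2))) 0 (\int[m]_t Num.sg (t - a)).
  have := has_hilbert_wave m (- (pi / 2)) 0 mphi.
  congr (has_hilbert _ _ _); apply: eq_Rintegral => t _.
  by rewrite mul0r opprK add0r sin_pihalf mulr1.
(* By the addition formulas the shifted wave depends on [m] only through its unshifted cosine and
   sine transforms. *)
have waveE m (s : R) : wave m (fun t => t - a) (- (pi / 2)) s =
    sin (s * a) * (\int[m]_t cos (s * t)) - cos (s * a) * (\int[m]_t sin (s * t)).
  have mT : (m [set: T] < +oo)%E by rewrite -ge0_fin_numE// fin_num_measure.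
  have ms : measurable_fun [set: T] (fun t : T => s * t) by exact: measurable_funM.
  have ic : m.-integrable [set: T] (EFin \o (fun t : T => cos (s * t))).
    apply: (@bounded_integrable _ _ _ _ _ _ 1) => //.
      exact: (measurableT_comp measurable_cos).
    by move=> t _; exact: cos_max.
  have is_ : m.-integrable [set: T] (EFin \o (fun t : T => sin (s * t))).
    apply: (@bounded_integrable _ _ _ _ _ _ 1) => //.
      exact: (measurableT_comp measurable_sin).
    by move=> t _; exact: sin_max.
  rewrite -!RintegralZl// -RintegralB//; [|exact: integrable_scalel|exact: integrable_scalel].
  apply: eq_Rintegral => t _; rewrite opprK.
  rewrite cosDpihalf mulrBr sinB; ring.
apply: (has_hilbert_unique (h m1)).
suff -> : wave m1 (fun t => t - a) (- (pi / 2)) = wave m2 (fun t => t - a) (- (pi / 2)) by exact: h.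
by apply/funext => s; rewrite !waveE hc hs.
Qed.

End Uniqueness.

(** * Complex measures *)

Section LinearInMeasure.
Context {R : realType} d (T : measurableType d).

(** Boundedness gives integrability against every finite measure at once, hence against the Jordan
    parts of all the charges that are compared. *)
Definition bmeasurable (D : set T) (f : T -> R) : Prop :=
  measurable_fun D f /\ exists M, forall x, D x -> `|f x| <= M.

Lemma finite_measure_lty (m : {finite_measure set T -> \bar R}) (D : set T) :
  measurable D -> (m D < +oo)%E.
Proof. by move=> mD; rewrite -ge0_fin_numE// fin_num_measure. Qed.

Lemma bmeasurable_integrable (m : {finite_measure set T -> \bar R}) (D : set T) (f : T -> R) :
  measurable D -> bmeasurable D f -> m.-integrable D (EFin \o f).
Proof.
move=> mD [mf [M fM]]; apply: (bounded_integrable mD _ mf fM).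
exact: finite_measure_lty.
Qed.

(* Moving the negative coefficients to the other side gives two measures that agree on [D]. *)
Lemma Rintegral_lin_measure (n : nat) (c : nat -> R)
    (m : nat -> {finite_measure set T -> \bar R}) (D : set T) (f : T -> R) :
  measurable D -> bmeasurable D f ->
  (forall A, measurable A -> A `<=` D -> \sum_(i < n) c i * fine (m i A) = 0) ->
  \sum_(i < n) c i * (\int[m i]_(x in D) f x) = 0.
Proof.
move=> mD bf; have [mf [M fM]] := bf => H.
have cp0 i : 0 <= Num.max (c i) 0 by rewrite le_max lexx orbT.
have cn0 i : 0 <= Num.max (- c i) 0 by rewrite le_max lexx orbT.
pose P : nat -> {measure set T -> \bar R} := fun i => mscale (NngNum (cp0 i)) (m i).
pose N : nat -> {measure set T -> \bar R} := fun i => mscale (NngNum (cn0 i)) (m i).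
have cE i : c i = Num.max (c i) 0 - Num.max (- c i) 0.
  have [h|h] := leP 0 (c i).
    by rewrite max_r ?oppr_le0// subr0.
  by rewrite max_l ?oppr_ge0 ?ltW// sub0r opprK.
have PN (A : set T) : measurable A -> A `<=` D -> msum P n A = msum N n A.
  move=> mA AD; rewrite /msum /P /N /mscale /=.
  have fin i : m i A = (fine (m i A))%:E by rewrite fineK// fin_num_measure.
  transitivity (\sum_(i < n) Num.max (c i) 0 * fine (m i A))%:E.
    by rewrite -sumEFin; apply: eq_bigr => i _; rewrite EFinM -fin.
  transitivity (\sum_(i < n) Num.max (- c i) 0 * fine (m i A))%:E.
    congr EFin; apply/eqP; rewrite -subr_eq0 -sumrB; apply/eqP.
    rewrite -[RHS](H A mA AD); apply: eq_bigr => i _.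
    by rewrite -mulrBl -cE.
  by rewrite -sumEFin; apply: eq_bigr => i _; rewrite EFinM -fin.
(* Adding the bound makes the integrand nonnegative, so its integral splits over sums and
   nonnegative multiples of measures; the contribution of [M] cancels by the hypothesis at
   [A = D]. *)
pose F x := f x + M.
have F0 x : D x -> (0 <= (F x)%:E)%E.
  by move=> /fM; rewrite lee_fin /F ler_norml -lerBlDr sub0r => /andP[].
have mF : measurable_fun D (EFin \o F).
  by apply/measurable_EFinP; exact: measurable_funD.
have intF i : (\int[m i]_(x in D) (F x)%:E =
    (\int[m i]_(x in D) f x + M * fine (m i D))%:E)%E.
  have ic : (m i).-integrable D (EFin \o cst M).
    exact: finite_measure_integrable_cst.
  have if_ := bmeasurable_integrable (m i) mD bf.
  rewrite EFinD -Rintegral_cst// /Rintegral !fineK; last 2 first.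
    exact: integrable_fin_num ic.
    exact: integrable_fin_num if_.
  by rewrite -integralD_EFin.
have intS (k : nat -> R) (k0 : forall i, 0 <= k i) :
    (\int[msum (fun i => mscale (NngNum (k0 i)) (m i)) n]_(x in D) (F x)%:E =
    (\sum_(i < n) k i * (\int[m i]_(x in D) f x + M * fine (m i D)))%:E)%E.
  rewrite ge0_integral_measure_sum// -sumEFin; apply: eq_bigr => i _.
  by rewrite ge0_integral_mscale// [LHS]/= intF EFinM.
have : (\int[msum P n]_(x in D) (F x)%:E = \int[msum N n]_(x in D) (F x)%:E)%E.
  exact: eq_measure_integral.
rewrite !intS => -[/eqP]; rewrite -subr_eq0 -sumrB => /eqP H1.
have H2 := H D mD (@subset_refl _ D).
transitivity (\sum_(i < n) c i * (\int[m i]_(x in D) f x + M * fine (m i D))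
   - M * \sum_(i < n) c i * fine (m i D)).
  by rewrite mulr_sumr -sumrB; apply: eq_bigr => i _; ring.
rewrite H2 mulr0 subr0 -[RHS]H1; apply: eq_bigr => i _.
by rewrite -mulrBl -cE.
Qed.

Definition charge_integral_on (nu : {charge set T -> \bar R}) (D : set T) (f : T -> R) : R :=
  (\int[jordan_pos (svalP (hahn_sets nu))]_(x in D) f x)
  - (\int[jordan_neg (svalP (hahn_sets nu))]_(x in D) f x).

(** Indexing the Jordan parts by a boolean lets [n] charges be listed as [2 n] finite measures, with
    the parity of the index choosing the part. *)
Definition charge_part (nu : {charge set T -> \bar R}) (b : bool) : {finite_measure set T -> \bar R} :=
  if b then (jordan_neg (svalP (hahn_sets nu)) : {finite_measure set T -> \bar R})
  else (jordan_pos (svalP (hahn_sets nu)) : {finite_measure set T -> \bar R}).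

Arguments charge_part : simpl never.

Lemma charge_partE (nu : {charge set T -> \bar R}) (A : set T) : measurable A ->
  fine (nu A) = fine (charge_part nu false A) - fine (charge_part nu true A).
Proof.
move=> mA; rewrite (jordan_decomp (svalP (hahn_sets nu)) mA) /cadd /=.
by rewrite cscaleN1 /= fineD ?fineN ?fin_numN ?fin_num_measure.
Qed.

Lemma norm_charge_le (nu : {charge set T -> \bar R}) (A : set T) : measurable A ->
  `|fine (nu A)| <= fine (charge_part nu false A) + fine (charge_part nu true A).
Proof.
move=> mA; rewrite (charge_partE nu mA).
have p0 (m : {finite_measure set T -> \bar R}) : 0 <= fine (m A) by exact: fine_ge0.
apply: le_trans (ler_normB _ _) _.
by rewrite (ger0_norm (p0 (charge_part nu false))) (ger0_norm (p0 (charge_part nu true))).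
Qed.

Let sum_double (n : nat) (F G : nat -> R) :
  \sum_(i < n.*2) (if odd i then G i./2 else F i./2) = \sum_(i < n) (F i + G i).
Proof.
elim: n => [|n IH]; first by rewrite !big_ord0.
rewrite doubleS !big_ord_recr /= IH -addrA; congr (_ + _).
by rewrite odd_double /= uphalf_double doubleK.
Qed.

(** The Jordan parts of a combination are not the combinations of the Jordan parts. Yet a vanishing
    combination of charges is one of finite measures, with opposite coefficients on the two parts,
    and for these the integrals are already known to obey it. *)
Lemma charge_integral_on_lin (n : nat) (c : nat -> R) (nu : nat -> {charge set T -> \bar R})
    (D : set T) (f : T -> R) : measurable D -> bmeasurable D f ->
  (forall A, measurable A -> A `<=` D -> \sum_(i < n) c i * fine (nu i A) = 0) ->
  \sum_(i < n) c i * charge_integral_on (nu i) D f = 0.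
Proof.
move=> mD bf H.
have := @Rintegral_lin_measure n.*2 (fun i => if odd i then - c i./2 else c i./2)
  (fun i => charge_part (nu i./2) (odd i)) D f mD bf.
have E (F : {finite_measure set T -> \bar R} -> R) :
    \sum_(i < n.*2) (if odd i then - c i./2 else c i./2) * F (charge_part (nu i./2) (odd i)) =
    \sum_(i < n) c i * (F (charge_part (nu i) false) - F (charge_part (nu i) true)).
  transitivity (\sum_(i < n) (c i * F (charge_part (nu i) false) +
      - c i * F (charge_part (nu i) true))); last first.
    by apply: eq_bigr => i _; ring.
  rewrite -(sum_double n (fun i => c i * F (charge_part (nu i) false))
    (fun i => - c i * F (charge_part (nu i) true))); apply: eq_bigr => i _; by case: (odd i).
rewrite (E (fun m => \int[m]_(x in D) f x)); apply => A mA AD.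
rewrite (E (fun m => fine (m A))) -[RHS](H A mA AD).
by apply: eq_bigr => i _; rewrite charge_partE.
Qed.

Lemma charge_integral_onD (nu : {charge set T -> \bar R}) (D : set T) (f g : T -> R) (a b : R) :
  measurable D -> bmeasurable D f -> bmeasurable D g ->
  charge_integral_on nu D (fun x => a * f x + b * g x) =
  a * charge_integral_on nu D f + b * charge_integral_on nu D g.
Proof.
move=> mD bf bg.
have E (m : {finite_measure set T -> \bar R}) : \int[m]_(x in D) (a * f x + b * g x) =
    a * \int[m]_(x in D) f x + b * \int[m]_(x in D) g x.
  have i1 := bmeasurable_integrable m mD bf; have i2 := bmeasurable_integrable m mD bg.
  by rewrite -!RintegralZl// -RintegralD//; exact: integrable_scalel.
by rewrite /charge_integral_on !E; ring.
Qed.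

Lemma charge_integral_onU (nu : {charge set T -> \bar R}) (D E : set T) (f : T -> R) :
  measurable D -> measurable E -> [disjoint D & E] -> bmeasurable (D `|` E) f ->
  charge_integral_on nu (D `|` E) f = charge_integral_on nu D f + charge_integral_on nu E f.
Proof.
move=> mD mE DE bf; have mDE : measurable (D `|` E) by exact: measurableU.
rewrite /charge_integral_on !Rintegral_setU//; first by ring.
  exact: (bmeasurable_integrable (charge_part nu true)).
exact: (bmeasurable_integrable (charge_part nu false)).
Qed.

Lemma eq_charge_integral_on (nu : {charge set T -> \bar R}) (D : set T) (f g : T -> R) :
  {in D, f =1 g} -> charge_integral_on nu D f = charge_integral_on nu D g.
Proof. by move=> fg; rewrite /charge_integral_on; congr (_ - _); exact: eq_Rintegral. Qed.

End LinearInMeasure.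

Local Open Scope complex_scope.
Local Notation normc := ComplexField.Normc.normc.

Section ComplexNorm.
Context {R : realType}.
Implicit Types z w : R[i].

Lemma complex_eqP z w : complex.Re z = complex.Re w -> complex.Im z = complex.Im w -> z = w.
Proof. by move=> h1 h2; apply/eqP; rewrite eq_complex h1 h2 !eqxx. Qed.

Lemma Re_mulc z w : complex.Re (z * w) = complex.Re z * complex.Re w - complex.Im z * complex.Im w.
Proof. by case: z => a b; case: w. Qed.

Lemma Im_mulc z w : complex.Im (z * w) = complex.Re z * complex.Im w + complex.Im z * complex.Re w.
Proof. by case: z => a b; case: w. Qed.

Lemma Re_addc z w : complex.Re (z + w) = complex.Re z + complex.Re w.
Proof. by case: z => a b; case: w. Qed.

Lemma Im_addc z w : complex.Im (z + w) = complex.Im z + complex.Im w.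
Proof. by case: z => a b; case: w. Qed.

Lemma Re_oppc z : complex.Re (- z) = - complex.Re z. Proof. by case: z. Qed.
Lemma Im_oppc z : complex.Im (- z) = - complex.Im z. Proof. by case: z. Qed.

Lemma normc_ge0 z : 0 <= normc z.
Proof. by case: z => a b; exact: sqrtr_ge0. Qed.

Lemma normc_triangle z w : normc (z + w) <= normc z + normc w.
Proof. exact: le_normcD. Qed.

Lemma normc_opp z : normc (- z) = normc z.
Proof. exact: normcN. Qed.

Lemma Re_le_normc z : `|complex.Re z| <= normc z.
Proof.
case: z => a b /=; rewrite -sqrtr_sqr ler_wsqrtr// lerDl sqr_ge0 //.
Qed.

Lemma Im_le_normc z : `|complex.Im z| <= normc z.
Proof.
case: z => a b /=; rewrite -sqrtr_sqr ler_wsqrtr// lerDr sqr_ge0 //.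
Qed.

Lemma normc_le_ReIm z : normc z <= `|complex.Re z| + `|complex.Im z|.
Proof.
case: z => a b /=; rewrite -[leRHS]ger0_norm ?addr_ge0// -sqrtr_sqr ler_wsqrtr//.
rewrite sqrrD !real_normK ?num_real//.
by rewrite [leRHS]addrAC lerDl mulrn_wge0// mulr_ge0.
Qed.

End ComplexNorm.
Arguments ComplexField.Normc.normc : simpl never.

(** * Operations on complex measures and their integrals *)

Section ComplexMeasureAlgebra.
Context {R : realType} d (T : measurableType d).
Notation cm := (complex_measure T R).
Implicit Types (mu nu : cm) (A D : set T).

(** The measure [a mu + nu]; this one operation serves for sums, multiples and differences,
    [cm_lin (-1) n m] being [m - n]. *)
Definition cm_lin (a : R[i]) mu nu : cm := ComplexMeasure
  (cadd (cadd (cscale (complex.Re a) (cm_re mu)) (cscale (- complex.Im a) (cm_im mu))) (cm_re nu))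
  (cadd (cadd (cscale (complex.Im a) (cm_re mu)) (cscale (complex.Re a) (cm_im mu))) (cm_im nu)).

Lemma cm_lin_value (a : R[i]) mu nu A : measurable A ->
  cm_value (cm_lin a mu nu) A = a * cm_value mu A + cm_value nu A.
Proof.
move=> mA; have fin (n : {charge set T -> \bar R}) : exists x : R, n A = x%:E.
  by exists (fine (n A)); rewrite fineK// fin_num_measure.
have cE (a1 a2 : R) (n1 n2 n3 : {charge set T -> \bar R}) :
    (cadd (cadd (cscale a1 n1) (cscale a2 n2)) n3 A = a1%:E * n1 A + a2%:E * n2 A + n3 A)%E.
  by [].
rewrite /cm_value /= !cE.
have [x1 ->] := fin (cm_re mu); have [x2 ->] := fin (cm_im mu).
have [x3 ->] := fin (cm_re nu); have [x4 ->] := fin (cm_im nu).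
by apply: complex_eqP; rewrite ?Re_addc ?Im_addc ?Re_mulc ?Im_mulc /=; ring.
Qed.

Definition cm_restr mu D (mD : measurable D) : cm :=
  ComplexMeasure (crestr0 (cm_re mu) mD) (crestr0 (cm_im mu) mD).

Lemma cm_restr_value mu D (mD : measurable D) A : measurable A ->
  cm_value (cm_restr mu mD) A = cm_value mu (A `&` D).
Proof. by move=> mA; rewrite /cm_value /= /crestr0 mem_set. Qed.

Definition cm_zero : cm := ComplexMeasure (@czero d T R) (@czero d T R).

Lemma cm_zero_value A : cm_value cm_zero A = 0.
Proof. by []. Qed.

Definition cm_dirac (x : T) : cm :=
  ComplexMeasure (charge_of_finite_measure (@dirac d T x R)) (@czero d T R).

Lemma cm_dirac_value (x : T) A : cm_value (cm_dirac x) A = (x \in A)%:R.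
Proof.
rewrite /cm_value /= /charge_of_finite_measure /= /dirac indicE /=.
by case: (x \in A).
Qed.

Lemma cm_value0 mu : cm_value mu set0 = 0.
Proof. by rewrite /cm_value !charge0. Qed.

Lemma cm_valueU mu A D : measurable A -> measurable D -> A `&` D = set0 ->
  cm_value mu (A `|` D) = cm_value mu A + cm_value mu D.
Proof.
move=> mA mD AD; rewrite /cm_value !chargeU// !fineD ?fin_num_measure//.
Qed.

Lemma cm_value_split mu A D : measurable A -> measurable D ->
  cm_value mu A = cm_value mu (A `&` D) + cm_value mu (A `&` ~` D).
Proof.
move=> mA mD; rewrite -cm_valueU//.
- by rewrite -setIUr setUv setIT.
- exact: measurableI.
- by apply: measurableI => //; exact: measurableC.
- by rewrite setIACA setICr setI0.
Qed.

Definition cbmeasurable D (f : T -> R[i]) : Prop :=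
  bmeasurable D (fun t => complex.Re (f t)) /\ bmeasurable D (fun t => complex.Im (f t)).

Definition cm_integral_on mu D (f : T -> R[i]) : R[i] :=
  (charge_integral_on (cm_re mu) D (fun t => complex.Re (f t))
     - charge_integral_on (cm_im mu) D (fun t => complex.Im (f t))) +i*
  (charge_integral_on (cm_re mu) D (fun t => complex.Im (f t))
     + charge_integral_on (cm_im mu) D (fun t => complex.Re (f t))).

Lemma cm_integralE mu f : cm_integral mu f = cm_integral_on mu setT f.
Proof. by []. Qed.

Let charge_lin3 (n n1 n2 n3 : {charge set T -> \bar R}) (a b : R) D (f : T -> R) :
  measurable D -> bmeasurable D f ->
  (forall A, measurable A -> A `<=` D ->
     fine (n A) = a * fine (n1 A) + b * fine (n2 A) + fine (n3 A)) ->
  charge_integral_on n D f = a * charge_integral_on n1 D f + b * charge_integral_on n2 D f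
     + charge_integral_on n3 D f.
Proof.
move=> mD bf H.
(* The coefficient [-1] on [n] turns the relation into a vanishing combination of four charges. *)
pose c (i : nat) : R := nth 0 [:: -1; a; b; 1] i.
pose nu (i : nat) : {charge set T -> \bar R} := nth n [:: n; n1; n2; n3] i.
have := @charge_integral_on_lin R d T 4 c nu D f mD bf.
rewrite !big_ord_recr big_ord0 /c /nu /= add0r mulN1r mul1r => E.
apply/eqP; rewrite eq_sym -subr_eq0; apply/eqP; rewrite -[RHS]E; first by ring.
move=> A mA AD; rewrite !big_ord_recr big_ord0 /c /nu /= add0r mulN1r mul1r H//.
by ring.
Qed.

(** Only subsets of [D] enter the hypothesis, so measures related differently on different pieces of
    the line can be compared piece by piece. *)
Lemma cm_integral_on_lin (a : R[i]) mu mu1 mu2 D f : measurable D -> cbmeasurable D f ->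
  (forall A, measurable A -> A `<=` D -> cm_value mu A = a * cm_value mu1 A + cm_value mu2 A) ->
  cm_integral_on mu D f = a * cm_integral_on mu1 D f + cm_integral_on mu2 D f.
Proof.
move=> mD [bf1 bf2] H.
have hre A : measurable A -> A `<=` D -> fine (cm_re mu A) =
    complex.Re a * fine (cm_re mu1 A) + (- complex.Im a) * fine (cm_im mu1 A) + fine (cm_re mu2 A).
  by move=> mA AD; have := congr1 (@complex.Re R) (H A mA AD); rewrite Re_addc Re_mulc /= mulNr.
have him A : measurable A -> A `<=` D -> fine (cm_im mu A) =
    complex.Re a * fine (cm_im mu1 A) + complex.Im a * fine (cm_re mu1 A) + fine (cm_im mu2 A).
  by move=> mA AD; have := congr1 (@complex.Im R) (H A mA AD); rewrite Im_addc Im_mulc.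
rewrite /cm_integral_on.
rewrite (charge_lin3 mD bf1 hre) (charge_lin3 mD bf2 hre).
rewrite (charge_lin3 mD bf1 him) (charge_lin3 mD bf2 him).
by apply: complex_eqP; rewrite ?Re_addc ?Im_addc ?Re_mulc ?Im_mulc /=; ring.
Qed.

Lemma cm_integral_on_eq mu mu1 D f : measurable D -> cbmeasurable D f ->
  (forall A, measurable A -> A `<=` D -> cm_value mu A = cm_value mu1 A) ->
  cm_integral_on mu D f = cm_integral_on mu1 D f.
Proof.
move=> mD bf H; rewrite (@cm_integral_on_lin 0 mu cm_zero mu1)// ?mul0r ?add0r//.
by move=> A mA AD; rewrite mul0r add0r H.
Qed.

Lemma cm_integral_on0 mu D f : measurable D -> cbmeasurable D f ->
  (forall A, measurable A -> A `<=` D -> cm_value mu A = 0) -> cm_integral_on mu D f = 0.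
Proof.
move=> mD bf H.
(* On subsets of [D] the zero values satisfy [mu = mu + mu], so the integral equals twice itself. *)
have : cm_integral_on mu D f = 1 * cm_integral_on mu D f + cm_integral_on mu D f.
  by apply: cm_integral_on_lin => // A mA AD; rewrite H// mulr0 addr0.
by move=> /eqP; rewrite mul1r eq_sym -subr_eq0 addrK => /eqP.
Qed.

Lemma cm_integral_onU mu D E f : measurable D -> measurable E -> [disjoint D & E] ->
  cbmeasurable (D `|` E) f ->
  cm_integral_on mu (D `|` E) f = cm_integral_on mu D f + cm_integral_on mu E f.
Proof.
move=> mD mE DE [b1 b2]; rewrite /cm_integral_on !charge_integral_onU//.
by apply: complex_eqP; rewrite ?Re_addc ?Im_addc /=; ring.
Qed.

Lemma eq_cm_integral_on mu D f g : {in D, f =1 g} ->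
  cm_integral_on mu D f = cm_integral_on mu D g.
Proof.
move=> fg; have e1 (k : R[i] -> R) n :
    charge_integral_on n D (fun t => k (f t)) = charge_integral_on n D (fun t => k (g t)).
  by apply: eq_charge_integral_on => t tD; rewrite fg.
by rewrite /cm_integral_on !(e1 (fun z => complex.Re z)) !(e1 (fun z => complex.Im z)).
Qed.

Lemma cm_integral_onZ mu D (c : R[i]) f : measurable D -> cbmeasurable D f ->
  cm_integral_on mu D (fun t => c * f t) = c * cm_integral_on mu D f.
Proof.
move=> mD [b1 b2]; rewrite /cm_integral_on.
have e1 n : charge_integral_on n D (fun t => complex.Re (c * f t)) =
    complex.Re c * charge_integral_on n D (fun t => complex.Re (f t)) +
    (- complex.Im c) * charge_integral_on n D (fun t => complex.Im (f t)).
  by rewrite -charge_integral_onD//; apply: eq_charge_integral_on => t _; rewrite Re_mulc mulNr.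
have e2 n : charge_integral_on n D (fun t => complex.Im (c * f t)) =
    complex.Re c * charge_integral_on n D (fun t => complex.Im (f t)) +
    complex.Im c * charge_integral_on n D (fun t => complex.Re (f t)).
  by rewrite -charge_integral_onD//; apply: eq_charge_integral_on => t _; rewrite Im_mulc.
by rewrite !e1 !e2; apply: complex_eqP; rewrite ?Re_mulc ?Im_mulc /=; ring.
Qed.

End ComplexMeasureAlgebra.

(** * Total variation *)

Section Variation.
Context {R : realType} d (T : measurableType d).
Notation cm := (complex_measure T R).
Implicit Types (mu nu : cm) (A D : set T).

Lemma finite_measure_sum_le (m : {finite_measure set T -> \bar R}) (F : nat -> set T) (n : nat) :
  (forall k, measurable (F k)) -> trivIset setT F ->
  \sum_(k < n) fine (m (F k)) <= fine (m setT).
Proof.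
move=> mF tF; rewrite -lee_fin fineK ?fin_num_measure// -sumEFin.
under eq_bigr => k _ do rewrite fineK ?fin_num_measure//.
rewrite -measure_bigsetU//; first by apply: le_measure; rewrite ?inE//; exact: bigsetU_measurable.
Qed.

Let total mu : R :=
  fine (charge_part (cm_re mu) false setT) + fine (charge_part (cm_re mu) true setT) +
  (fine (charge_part (cm_im mu) false setT) + fine (charge_part (cm_im mu) true setT)).

Let sum_le_total mu (F : nat -> set T) (n : nat) : countable_partition F ->
  \sum_(k < n) normc (cm_value mu (F k)) <= total mu.
Proof.
move=> [mF tF _].
pose g (m : {finite_measure set T -> \bar R}) := \sum_(k < n) fine (m (F k)).
apply: (@le_trans _ _ (g (charge_part (cm_re mu) false) + g (charge_part (cm_re mu) true) +
    (g (charge_part (cm_im mu) false) + g (charge_part (cm_im mu) true)))); last first.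
  by rewrite /total; apply: lerD; apply: lerD; exact: finite_measure_sum_le.
rewrite /g -!big_split /=; apply: ler_sum => k _.
apply: le_trans (normc_le_ReIm _) _; apply: lerD.
  exact: (norm_charge_le (cm_re mu) (mF k)).
exact: (norm_charge_le (cm_im mu) (mF k)).
Qed.

Let variation_le mu (M : R) :
  (forall F n, countable_partition F -> \sum_(k < n) normc (cm_value mu (F k)) <= M) ->
  (cm_variation mu <= M%:E)%E.
Proof.
move=> H; apply: ge_ereal_sup => _ [F pF <-].
apply: lime_le.
  by apply: is_cvg_nneseries => k _ _; rewrite lee_fin normc_ge0.
apply: nearW => n; rewrite big_mkord sumEFin lee_fin.
exact: H.
Qed.

Let variation_ge mu F n : countable_partition F ->
  ((\sum_(k < n) normc (cm_value mu (F k)))%:E <= cm_variation mu)%E.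
Proof.
move=> pF; apply: (@le_trans _ _ (\sum_(0 <= k <oo) (normc (cm_value mu (F k)))%:E)%E).
  rewrite -sumEFin -(big_mkord xpredT (fun k => (normc (cm_value mu (F k)))%:E)).
  by apply: nneseries_lim_ge => k _ _; rewrite lee_fin normc_ge0.
by apply: ereal_sup_ubound; exists F.
Qed.

Definition two_partition A (k : nat) : set T :=
  if k is 0%N then A else if k is 1%N then ~` A else set0.

Lemma two_partitionP A : measurable A -> countable_partition (two_partition A).
Proof.
move=> mA; split.
- by move=> [|[|k]] //=; exact: measurableC.
- apply/trivIsetP => -[|[|i]] [|[|j]] //= _ _ _; rewrite ?setI0 ?set0I//.
  + by rewrite setICr.
  + by rewrite setICl.
- apply/seteqP; split => // x _.
  by have [Ax|nAx] := pselect (A x); [exists 0%N|exists 1%N].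
Qed.

(** The masses of the four Jordan parts bound the variation. Finiteness is essential because [fine]
    would send an infinite variation to [0]. *)
Let variation_fin mu : cm_variation mu = (cm_norm mu)%:E.
Proof.
rewrite /cm_norm fineK// ge0_fin_numE; last first.
  by have := variation_ge mu 0 (two_partitionP (@measurable0 _ T)); rewrite big_ord0.
apply: le_lt_trans (ltry (total mu)); apply: variation_le => F n.
exact: sum_le_total.
Qed.

Lemma cm_norm_ge mu F n : countable_partition F ->
  \sum_(k < n) normc (cm_value mu (F k)) <= cm_norm mu.
Proof. by move=> pF; rewrite -lee_fin -variation_fin; exact: variation_ge. Qed.

Lemma cm_norm_le mu (M : R) :
  (forall F n, countable_partition F -> \sum_(k < n) normc (cm_value mu (F k)) <= M) ->
  cm_norm mu <= M.
Proof. by move=> H; rewrite -lee_fin -variation_fin; exact: variation_le. Qed.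

Lemma cm_value_le mu A : measurable A -> normc (cm_value mu A) <= cm_norm mu.
Proof.
move=> mA; have := cm_norm_ge mu 1 (two_partitionP mA).
by rewrite big_ord_recr big_ord0 /= add0r.
Qed.

Lemma cm_norm_eq mu nu : (forall A, measurable A -> cm_value mu A = cm_value nu A) ->
  cm_norm mu = cm_norm nu.
Proof.
move=> H; apply/eqP; rewrite eq_le; apply/andP; split; apply: cm_norm_le => F n pF;
  have [mF _ _] := pF.
  by under eq_bigr => k _ do rewrite H//; exact: cm_norm_ge.
by under eq_bigr => k _ do rewrite -H//; exact: cm_norm_ge.
Qed.

Lemma cm_norm_lin_le (a : R[i]) mu mu1 mu2 :
  (forall A, measurable A -> cm_value mu A = a * cm_value mu1 A + cm_value mu2 A) ->
  cm_norm mu <= normc a * cm_norm mu1 + cm_norm mu2.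
Proof.
move=> H; apply: cm_norm_le => F n pF; have [mF _ _] := pF.
apply: (@le_trans _ _ (normc a * \sum_(k < n) normc (cm_value mu1 (F k)) +
    \sum_(k < n) normc (cm_value mu2 (F k)))); last first.
  by apply: lerD; [rewrite ler_wpM2l ?normc_ge0//|]; exact: cm_norm_ge.
rewrite mulr_sumr -big_split; apply: ler_sum => k _ /=.
by rewrite H// -ComplexField.Normc.normcM normc_triangle.
Qed.

Lemma cm_norm_zero : cm_norm (@cm_zero R d T) = 0.
Proof.
apply/eqP; rewrite eq_le; apply/andP; split.
  apply: cm_norm_le => F n _.
  by rewrite big1// => k _; rewrite cm_zero_value ComplexField.Normc.normc0.
have := cm_norm_ge (@cm_zero R d T) 0 (two_partitionP (@measurable0 _ T)).
by rewrite big_ord0.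
Qed.

(** One inequality is the triangle inequality with a zero summand; the other is the same inequality
    for [a^-1] when [a] is not [0]. *)
Lemma cm_norm_scale (a : R[i]) mu nu :
  (forall A, measurable A -> cm_value mu A = a * cm_value nu A) ->
  cm_norm mu = normc a * cm_norm nu.
Proof.
move=> H.
have le (b : R[i]) m1 m2 : (forall A, measurable A -> cm_value m1 A = b * cm_value m2 A) ->
    cm_norm m1 <= normc b * cm_norm m2.
  move=> Hb; have := @cm_norm_lin_le b m1 m2 (@cm_zero R d T).
  rewrite cm_norm_zero addr0; apply => A mA.
  by rewrite cm_zero_value addr0 Hb.
apply/eqP; rewrite eq_le le//=.
have [->|a0] := eqVneq a 0.
  rewrite ComplexField.Normc.normc0 mul0r.
  by apply: le_trans (cm_value_le mu measurable0); exact: normc_ge0.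
have n0 : 0 < normc a.
  rewrite lt_neqAle normc_ge0 andbT eq_sym; apply/eqP => /ComplexField.Normc.eq0_normc/eqP.
  exact/negP.
rewrite -ler_pdivlMl// -ComplexField.Normc.normcV; apply: le => A mA.
by rewrite H// mulrA mulVf// mul1r.
Qed.

Let interleave (F : nat -> set T) D (k : nat) : set T :=
  if odd k then F k./2 `&` ~` D else F k./2 `&` D.

Let interleaveP (F : nat -> set T) D : measurable D -> countable_partition F ->
  countable_partition (interleave F D).
Proof.
move=> mD [mF tF cF]; split.
- move=> k; rewrite /interleave; case: ifP => _; apply: measurableI => //.
  exact: measurableC.
- apply/trivIsetP => i j _ _ ij.
  have [e|ne] := eqVneq i./2 j./2; last first.
    have /trivIsetP/(_ _ _ Logic.I Logic.I ne) Fij := tF.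
    rewrite -subset0 -Fij /interleave => x.
    by case: ifP => _; case: ifP => _ [[? _] [? _]].
  have : odd i != odd j.
    apply: contra ij => /eqP o.
    by rewrite -(odd_double_half i) -(odd_double_half j) o e.
  rewrite -subset0 /interleave => oij x.
  by case: (odd i) (odd j) oij => -[] // _ [[_ h1] [_ h2]].
- apply/seteqP; split => // x _.
  have : (\bigcup_k F k) x by rewrite cF.
  move=> [k _ Fx]; have [Dx|nDx] := pselect (D x).
    by exists k.*2 => //; rewrite /interleave odd_double doubleK.
  by exists k.*2.+1 => //; rewrite /interleave /= odd_double /= uphalf_double.
Qed.

(* Split every block of a partition along [D]. *)
Lemma cm_norm_twist_le mu nu D (a b : R[i]) : measurable D -> normc a <= 1 -> normc b <= 1 ->
  (forall A, measurable A ->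
     cm_value mu A = a * cm_value nu (A `&` D) + b * cm_value nu (A `&` ~` D)) ->
  cm_norm mu <= cm_norm nu.
Proof.
move=> mD a1 b1 H; apply: cm_norm_le => F n pF; have [mF _ _] := pF.
(* The first [2 n] blocks of the refined partition are the halves of the first [n] blocks. *)
apply: le_trans (cm_norm_ge nu n.*2 (interleaveP mD pF)).
have -> : \sum_(k < n.*2) normc (cm_value nu (interleave F D k)) =
    \sum_(k < n) (normc (cm_value nu (F k `&` D)) + normc (cm_value nu (F k `&` ~` D))).
  elim: n => [|n IH]; first by rewrite !big_ord0.
  rewrite doubleS !big_ord_recr /= IH -addrA /interleave /= odd_double /=.
  by rewrite uphalf_double doubleK.
apply: ler_sum => k _; rewrite H//; apply: le_trans (normc_triangle _ _) _.
by rewrite !ComplexField.Normc.normcM; apply: lerD; rewrite ler_piMl ?normc_ge0.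
Qed.

End Variation.

(** * Completeness of the space of complex measures *)

Section Completeness.
Context {R : realType} d (T : measurableType d).
Notation cm := (complex_measure T R).

Section ChargeLimit.
Variables (r : nat -> {charge set T -> \bar R}).
Hypothesis cauchy : forall e : R, 0 < e -> exists N : nat, forall m n : nat,
  (N <= m)%N -> (N <= n)%N -> forall A, measurable A ->
  `|fine (r m A) - fine (r n A)| <= e.

Let lim_value (A : set T) : R := lim (fine (r n A) @[n --> \oo]).

Let lim_valueP (A : set T) : measurable A -> fine (r n A) @[n --> \oo] --> lim_value A.
Proof.
move=> mA; apply/cauchy_cvgP/cauchy_exP => e e0.
have e20 : 0 < e / 2 by rewrite divr_gt0.
have [N HN] := cauchy e20.
exists (fine (r N A)); exists N => // n Nn /=.
by rewrite /ball /=; apply: le_lt_trans (HN N n _ _ A mA) _ => //; lra.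
Qed.

(** Letting one index of the Cauchy estimate tend to infinity keeps it uniform in [A]. *)
Let unif (e : R) : 0 < e -> exists N : nat, forall n : nat, (N <= n)%N ->
  forall A, measurable A -> `|fine (r n A) - lim_value A| <= e.
Proof.
move=> e0; have [N HN] := cauchy e0; exists N => n Nn A mA.
have h : `|fine (r n A) - fine (r m A)| @[m --> \oo] --> `|fine (r n A) - lim_value A|.
  by apply: cvg_norm; apply: cvgB; [exact: cvg_cst|exact: lim_valueP].
rewrite -(cvg_lim (@Rhausdorff R) h); apply: limr_le; first by apply/cvg_ex; eexists; exact: h.
by exists N => // m Nm /=; exact: HN.
Qed.

Let limc (A : set T) : \bar R := (if A \in measurable then lim_value A else 0)%:E.

Let limcE (A : set T) : measurable A -> limc A = (lim_value A)%:E.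
Proof. by move=> mA; rewrite /limc mem_set. Qed.

Let limc0 : limc set0 = 0%E.
Proof.
rewrite limcE//; congr EFin; apply/cvg_lim; first exact: Rhausdorff.
by under eq_cvg => n do rewrite charge0; exact: cvg_cst.
Qed.

Let limc_fin (A : set T) : measurable A -> limc A \is a fin_num.
Proof. by []. Qed.

Let lim_valueU (F : nat -> set T) n : (forall k, measurable (F k)) -> trivIset setT F ->
  lim_value (\big[setU/set0]_(k < n) F k) = \sum_(k < n) lim_value (F k).
Proof.
move=> mF tF; apply/cvg_lim; first exact: Rhausdorff.
have E m : fine (r m (\big[setU/set0]_(k < n) F k)) = \sum_(k < n) fine (r m (F k)).
  rewrite charge_semi_additive//; last exact: bigsetU_measurable.
  by rewrite sum_fine// => k _; rewrite fin_num_measure.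
under eq_cvg => m do rewrite E.
by apply: cvg_big => [|k _]; [exact: add_continuous|exact: lim_valueP].
Qed.

(** An [e / 3] argument: a single [r N] is uniformly close to the limit, both on the full union and
    on every finite union, and [r N] itself is countably additive. *)
Let limc_sigma : semi_sigma_additive limc.
Proof.
move=> F mF tF mUF; rewrite limcE//.
have E n : (\sum_(0 <= k < n) limc (F k))%E = (\sum_(k < n) lim_value (F k))%:E.
  by rewrite big_mkord -sumEFin; apply: eq_bigr => k _; rewrite limcE.
under eq_cvg => n do rewrite E.
apply: cvg_EFin; first exact: nearW.
apply/cvgrPdist_le => e e0.
have e30 : 0 < e / 3 by rewrite divr_gt0.
have [N HN] := unif e30.
have := @charge_semi_sigma_additive _ _ _ (r N) F mF tF mUF.
rewrite -(fineK (fin_num_measure (r N) _ mUF)) => /fine_cvgP[_ /cvgrPdist_le/(_ _ e30)].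
apply: filterS => n /= Hn; rewrite -lim_valueU//.
have E2 : fine (\sum_(0 <= k < n) r N (F k)) = fine (r N (\big[setU/set0]_(k < n) F k)).
  by rewrite charge_semi_additive ?big_mkord//; exact: bigsetU_measurable.
rewrite E2 in Hn.
have H1 := HN N (leqnn N) _ mUF.
have mB : measurable (\big[setU/set0]_(k < n) F k) by exact: bigsetU_measurable.
have H2 := HN N (leqnn N) _ mB.
set a := lim_value (\bigcup_n F n) in H1 *.
set b := lim_value _ in H2 *.
move: Hn H1 H2; move: (fine (r N _)) (fine (r N _)) => p q.
by rewrite !ler_norml => /andP[? ?] /andP[? ?] /andP[? ?]; apply/andP; split; lra.
Qed.

HB.instance Definition _ := isCharge.Build _ T R limc limc0 limc_fin limc_sigma.

Lemma charge_uniform_limit : exists l : {charge set T -> \bar R},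
  forall e : R, 0 < e -> exists N : nat, forall n : nat, (N <= n)%N ->
  forall A, measurable A -> `|fine (r n A) - fine (l A)| <= e.
Proof.
exists limc => e e0; have [N HN] := unif e0; exists N => n Nn A mA.
have -> : fine ((limc : {charge set T -> \bar R}) A) = lim_value A.
  by change (fine (limc A) = lim_value A); rewrite limcE.
exact: HN.
Qed.

End ChargeLimit.

Variable mu_ : nat -> cm.

Let diff (m n : nat) : cm := cm_lin (-1) (mu_ n) (mu_ m).

Let diff_value m n A : measurable A ->
  cm_value (diff m n) A = cm_value (mu_ m) A - cm_value (mu_ n) A.
Proof. by move=> mA; rewrite cm_lin_value// mulN1r addrC. Qed.

(** Cauchy in variation means uniformly Cauchy on sets, which yields a limit charge for each part.
    Closeness on sets does not bound the variation directly; for finitely many blocks one passes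
    through a later term of the sequence. *)
Lemma cm_complete : (forall e : R, 0 < e -> exists N : nat, forall m n : nat,
    (N <= m)%N -> (N <= n)%N -> cm_norm (cm_lin (-1) (mu_ n) (mu_ m)) < e) ->
  exists mu : cm, (fun n => cm_norm (cm_lin (-1) mu (mu_ n))) @ \oo --> (0 : R).
Proof.
move=> cauchy.
have cre (e : R) : 0 < e -> exists N : nat, forall m n : nat,
    (N <= m)%N -> (N <= n)%N -> forall A, measurable A ->
    `|fine (cm_re (mu_ m) A) - fine (cm_re (mu_ n) A)| <= e.
  move=> e0; have [N HN] := cauchy e e0; exists N => m n Nm Nn A mA.
  apply: le_trans (ltW (HN m n Nm Nn)); apply: le_trans (cm_value_le _ mA).
  by rewrite (diff_value _ _ mA); apply: le_trans (Re_le_normc _); rewrite Re_addc Re_oppc.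
have cim (e : R) : 0 < e -> exists N : nat, forall m n : nat,
    (N <= m)%N -> (N <= n)%N -> forall A, measurable A ->
    `|fine (cm_im (mu_ m) A) - fine (cm_im (mu_ n) A)| <= e.
  move=> e0; have [N HN] := cauchy e e0; exists N => m n Nm Nn A mA.
  apply: le_trans (ltW (HN m n Nm Nn)); apply: le_trans (cm_value_le _ mA).
  by rewrite (diff_value _ _ mA); apply: le_trans (Im_le_normc _); rewrite Im_addc Im_oppc.
have [lr Hr] := charge_uniform_limit cre.
have [li Hi] := charge_uniform_limit cim.
exists (ComplexMeasure lr li); set mu := ComplexMeasure lr li.
have near_value (e : R) : 0 < e -> exists N : nat, forall n : nat, (N <= n)%N ->
    forall A, measurable A -> normc (cm_value (mu_ n) A - cm_value mu A) <= e.
  move=> e0; have e20 : 0 < e / 2 by rewrite divr_gt0.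
  have [N1 H1] := Hr _ e20; have [N2 H2] := Hi _ e20.
  exists (maxn N1 N2) => n; rewrite geq_max => /andP[n1 n2] A mA.
  apply: le_trans (normc_le_ReIm _) _; rewrite Re_addc Im_addc Re_oppc Im_oppc /= [leRHS]splitr.
  by apply: lerD; [exact: H1|exact: H2].
apply/cvgrPdist_le => e e0; have e20 : 0 < e / 2 by rewrite divr_gt0.
have [N HN] := cauchy _ e20; exists N => // n /= Nn.
rewrite sub0r normrN.
have n0 : 0 <= cm_norm (cm_lin (-1) mu (mu_ n)).
  by apply: le_trans (cm_value_le _ measurable0); exact: normc_ge0.
rewrite ger0_norm//; apply: cm_norm_le => F K pF; have [mF _ _] := pF.
(* The error on each of the [K] blocks; [K.+1] keeps it positive for [K = 0]. The later index [m]
   may depend on [K], since the resulting bound [e] does not. *)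
have d0 : 0 < e / 2 / K.+1%:R by rewrite divr_gt0.
have [N' HN'] := near_value _ d0.
pose m := maxn N N'.
apply: (@le_trans _ _ (\sum_(k < K) normc (cm_value (diff n m) (F k)) +
    \sum_(k < K) (e / 2 / K.+1%:R))).
  rewrite -big_split; apply: ler_sum => k _ /=.
  rewrite diff_value// cm_lin_value// mulN1r [- _ + _]addrC.
  have -> : cm_value (mu_ n) (F k) - cm_value mu (F k) =
      (cm_value (mu_ n) (F k) - cm_value (mu_ m) (F k)) +
      (cm_value (mu_ m) (F k) - cm_value mu (F k)) by rewrite addrA subrK.
  apply: le_trans (normc_triangle _ _) _; rewrite lerD2l.
  by apply: HN' => //; exact: leq_maxr.
rewrite [leRHS]splitr; apply: lerD.
  apply: le_trans (cm_norm_ge _ _ pF) _; apply/ltW/HN => //; exact: leq_maxl.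
rewrite sumr_const card_ord; move: (e / 2) e20 => e2 e20.
rewrite -[_ *+ K]mulr_natr mulrAC ler_pdivrMr// ler_wpM2l ?ler_nat//.
exact: ltW.
Qed.

End Completeness.

(** * The Hilbert transform of a Fourier-Stieltjes transform *)

Section HilbertOfFourier.
Context {R : realType}.
Notation mu := (@lebesgue_measure R).
Notation T := (measurableTypeR R).

Lemma cvg_complex (U : Type) (F : set_system U) (FF : Filter F) (f : U -> R[i]) (a b : R) :
  complex.Re (f u) @[u --> F] --> a -> complex.Im (f u) @[u --> F] --> b ->
  (f : U -> R[i]^o) @ F --> (a +i* b : R[i]^o).
Proof.
move=> fa fb; apply/cvgrPdist_lt => e e0.
(* In the order of [R[i]] a positive element is real. *)
have eE : e = (complex.Re e)%:C.
  by apply/eqP; rewrite eq_complex /= eqxx; move: e0; rewrite ltcE /= => /andP[].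
have e10 : 0 < complex.Re e by move: e0; rewrite ltcE /= => /andP[].
have e20 : 0 < complex.Re e / 2 by rewrite divr_gt0.
move/cvgrPdist_lt : fa => /(_ _ e20); move/cvgrPdist_lt : fb => /(_ _ e20).
apply: filterS2 => u h1 h2; rewrite eE -[`|_|]/((normc (a +i* b - f u))%:C) ltcR.
apply: le_lt_trans (normc_le_ReIm (a +i* b - f u)) _.
by rewrite Re_addc Im_addc Re_oppc Im_oppc /= [ltRHS]splitr ltrD.
Qed.

Lemma Re_hilbert_kernel (f : R -> R[i]) (x t : R) :
  complex.Re (hilbert_kernel f x t) = complex.Re (f t) / (x - t).
Proof. by rewrite /hilbert_kernel -fmorphV Re_mulc /= mulr0 subr0. Qed.

Lemma Im_hilbert_kernel (f : R -> R[i]) (x t : R) :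
  complex.Im (hilbert_kernel f x t) = complex.Im (f t) / (x - t).
Proof. by rewrite /hilbert_kernel -fmorphV Im_mulc /= mulr0 add0r. Qed.

Lemma has_hilbert_complex (f : R -> R[i]) (x a b : R) :
  has_hilbert (fun s => complex.Re (f s)) x a ->
  has_hilbert (fun s => complex.Im (f s)) x b ->
  hilbert_defined_at f x /\ hilbert f x = a +i* b.
Proof.
move=> [ia la] [ib lb].
have pi0 : (pi : R) != 0 by rewrite gt_eqF// pi_gt0.
have h : hilbert_truncation f x @ @hilbert_filter R --> (a +i* b : R[i]^o).
  apply: cvg_complex.
  - have -> : a = pi^-1 * (pi * a) by rewrite mulrA mulVf// mul1r.
    apply: cvg_trans (cvgMl_tmp la); apply: near_eq_cvg; apply: nearW => -[e N] /=.
    rewrite mul0r subr0 /hkernel; congr (_ * (_ + _)).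
      by apply: eq_Rintegral => t _; rewrite Re_hilbert_kernel.
    by apply: eq_Rintegral => t _; rewrite Re_hilbert_kernel.
  - have -> : b = pi^-1 * (pi * b) by rewrite mulrA mulVf// mul1r.
    apply: cvg_trans (cvgMl_tmp lb); apply: near_eq_cvg; apply: nearW => -[e N] /=.
    rewrite mul0r addr0 /hkernel; congr (_ * (_ + _)).
      by apply: eq_Rintegral => t _; rewrite Im_hilbert_kernel.
    by apply: eq_Rintegral => t _; rewrite Im_hilbert_kernel.
split; last by have := @cvg_lim R[i]^o (@norm_hausdorff _ _) _ _ _ _ _ h; exact.
split; last by apply/cvg_ex; exists (a +i* b).
move=> e N e0; have [a1 a2] := ia e N e0; have [b1 b2] := ib e N e0.
by split; split; [move: a1|move: b1|move: a2|move: b2]; apply: eq_integrable => // t _;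
  rewrite ?Re_hilbert_kernel ?Im_hilbert_kernel.
Qed.

Lemma has_hilbert_charge (nu : {charge set T -> \bar R}) (th x : R) :
  has_hilbert (fun s => charge_integral_on nu setT (fun t => cos (s * t - th))) x
    (charge_integral_on nu setT (fun t => Num.sg t * sin (x * t - th))).
Proof.
have mid : measurable_fun [set: T] (fun t : T => t : R) by exact: measurable_id.
have h b := has_hilbert_wave (charge_part nu b) th x mid.
have := has_hilbert_lin 1 (-1) (h false) (h true).
have E (y z : R) : 1 * y + -1 * z = y - z by rewrite mul1r mulN1r.
rewrite E; congr (has_hilbert _ _ _).
by apply/funext => s; rewrite E.
Qed.

(* [i * sgn t * exp (- i x t)] *)
Definition twist_kernel (x t : R) : R[i] :=
  (Num.sg t * sin (x * t)) +i* (Num.sg t * cos (x * t)).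

Lemma hilbert_fourier (m : M_R R) (x : R) :
  hilbert_defined_at (fourier m) x /\
  hilbert (fourier m) x = ((Num.sqrt (2 * pi))^-1)%:C * cm_integral m (twist_kernel x).
Proof.
set c := (Num.sqrt (2 * pi))^-1.
pose C (nu : {charge set T -> \bar R}) s := charge_integral_on nu setT (fun t => cos (s * t)).
pose S (nu : {charge set T -> \bar R}) s := charge_integral_on nu setT (fun t => - sin (s * t)).
(* Phases [0] and [- pi / 2] treat [cos (s t)] and [- sin (s t)], the real and imaginary parts of
   [exp (- i s t)]. *)
have hC nu : has_hilbert (C nu) x (charge_integral_on nu setT (fun t => Num.sg t * sin (x * t))).
  have := has_hilbert_charge nu 0 x; congr (has_hilbert _ _ _).
    by apply/funext => s; apply: eq_charge_integral_on => t _; rewrite subr0.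
  by apply: eq_charge_integral_on => t _; rewrite subr0.
have hS nu : has_hilbert (S nu) x (charge_integral_on nu setT (fun t => Num.sg t * cos (x * t))).
  have := has_hilbert_charge nu (- (pi / 2)) x; congr (has_hilbert _ _ _).
    by apply/funext => s; apply: eq_charge_integral_on => t _; rewrite opprK cosDpihalf.
  by apply: eq_charge_integral_on => t _; rewrite opprK sinDpihalf.
have hr := has_hilbert_lin c (- c) (hC (cm_re m)) (hS (cm_im m)).
have hi := has_hilbert_lin c c (hS (cm_re m)) (hC (cm_im m)).
have Ere : (fun s => complex.Re (fourier m s)) = (fun s => c * C (cm_re m) s + - c * S (cm_im m) s).
  by apply/funext => s; rewrite /fourier Re_mulc /= mul0r subr0 mulNr -mulrBr.
have Eim : (fun s => complex.Im (fourier m s)) = (fun s => c * S (cm_re m) s + c * C (cm_im m) s).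
  by apply/funext => s; rewrite /fourier Im_mulc /= mul0r addr0 -mulrDr.
rewrite -Ere in hr; rewrite -Eim in hi.
have [H1 H2] := has_hilbert_complex hr hi.
split=> //; rewrite H2; apply: complex_eqP; rewrite ?Re_mulc ?Im_mulc /= mul0r.
  by rewrite subr0 mulNr -mulrBr.
by rewrite addr0 -mulrDr.
Qed.

End HilbertOfFourier.

(** * Injectivity of the Fourier transform, and [H] as an operation on measures *)

Section FourierSpace.
Context {R : realType}.
Notation T := (measurableTypeR R).
Implicit Types m n : M_R R.

Notation cm0 := (@cm_zero R _ T).
Notation c := ((Num.sqrt (2 * pi))^-1 : R).

Lemma fourier_const_gt0 : 0 < c.
Proof. by rewrite invr_gt0 sqrtr_gt0 mulr_gt0// pi_gt0. Qed.

Lemma cbmeasurable_expmi (x : R) (D : set T) : measurable D ->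
  cbmeasurable D (fun t : T => expmi (x * t)).
Proof.
move=> mD; have mx : measurable_fun D (fun t : T => x * t) by exact: measurable_funM.
split; split => /=.
- by apply: measurableT_comp => //; exact: measurable_cos.
- by exists 1 => t _; exact: cos_max.
- by apply: measurableT_comp => //; apply: measurableT_comp => //; exact: measurable_sin.
- by exists 1 => t _; rewrite normrN; exact: sin_max.
Qed.

Lemma cbmeasurable_twist (x : R) (D : set T) : measurable D ->
  cbmeasurable D (twist_kernel x : T -> R[i]).
Proof.
move=> mD; have mx : measurable_fun D (fun t : T => x * t) by exact: measurable_funM.
have ms : measurable_fun D (fun t : T => Num.sg (t : R)).
  by apply: measurable_funTS; exact: measurable_sg.
have sg1 (t : R) : `|Num.sg t| <= 1 by rewrite normr_sg; case: (t != 0).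
split; split => /=.
- by apply: measurable_funM => //; apply: measurableT_comp => //; exact: measurable_sin.
- by exists 1 => t _; rewrite normrM mulr_ile1// sin_max.
- by apply: measurable_funM => //; apply: measurableT_comp => //; exact: measurable_cos.
- by exists 1 => t _; rewrite normrM mulr_ile1// cos_max.
Qed.

Lemma fourier_lin (a : R[i]) m m1 m2 :
  (forall A, measurable A -> cm_value m A = a * cm_value m1 A + cm_value m2 A) ->
  fourier m = a *: fourier m1 + fourier m2.
Proof.
move=> H; apply/funext => x.
rewrite [RHS]/(a * fourier m1 x + fourier m2 x) /fourier !cm_integralE.
rewrite (@cm_integral_on_lin _ _ _ a m m1 m2)//.
- by rewrite mulrDr mulrCA.
- exact: cbmeasurable_expmi.
- by move=> A mA _; exact: H.
Qed.

Lemma fourier_ext m n : (forall A, measurable A -> cm_value m A = cm_value n A) ->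
  fourier m = fourier n.
Proof.
move=> H; apply/funext => x; rewrite /fourier !cm_integralE.
rewrite (@cm_integral_on_eq _ _ _ m n)//; first exact: cbmeasurable_expmi.
by move=> A mA _; exact: H.
Qed.

Lemma fourier_zero : fourier cm0 = 0.
Proof.
apply/funext => x; rewrite /fourier cm_integralE cm_integral_on0 ?mulr0//.
exact: cbmeasurable_expmi.
Qed.

Let C (nu : {charge set T -> \bar R}) (s : R) := charge_integral_on nu setT (fun t => cos (s * t)).
Let S (nu : {charge set T -> \bar R}) (s : R) := charge_integral_on nu setT (fun t => sin (s * t)).

Lemma charge_transform0 (nu : {charge set T -> \bar R}) :
  (forall s, C nu s = 0) -> (forall s, S nu s = 0) ->
  forall A, measurable A -> fine (nu A) = 0.
Proof.
move=> hC hS A mA; rewrite charge_partE//.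
rewrite (@fourier_measure_unique R (charge_part nu false) (charge_part nu true))// ?subrr//.
- by move=> s; apply/eqP; rewrite -subr_eq0; apply/eqP; exact: hC.
- by move=> s; apply/eqP; rewrite -subr_eq0; apply/eqP; exact: hS.
Qed.

Let CN nu s : C nu (- s) = C nu s.
Proof. by apply: eq_charge_integral_on => t _; rewrite mulNr cosN. Qed.

Let Sbm (s : R) : bmeasurable setT (fun t : T => sin (s * t)).
Proof.
split; last by exists 1 => t _; exact: sin_max.
by apply: measurableT_comp; [exact: measurable_sin|exact: measurable_funM].
Qed.

Let Sscale nu s : charge_integral_on nu setT (fun t : T => - sin (s * t)) = - S nu s.
Proof.
transitivity (-1 * S nu s + 0 * S nu s); last by rewrite mul0r addr0 mulN1r.
rewrite -charge_integral_onD//; apply: eq_charge_integral_on => t _.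
by rewrite mul0r addr0 mulN1r.
Qed.

Let SN nu s : S nu (- s) = - S nu s.
Proof. by rewrite -Sscale; apply: eq_charge_integral_on => t _; rewrite mulNr sinN. Qed.

(** The real and imaginary parts of the transform mix the two charges. Comparing [x] with [- x]
    separates the even cosine transforms from the odd sine transforms, so each charge has vanishing
    transforms. *)
Lemma fourier_eq0 m : fourier m = 0 -> forall A, measurable A -> cm_value m A = 0.
Proof.
move=> m0.
have E x : cm_integral_on m setT (fun t => expmi (x * t)) = 0.
  have := congr1 (fun f => f x) m0; rewrite /fourier => /eqP; rewrite mulf_eq0.
  case/orP => [|/eqP//]; rewrite eq_complex /= eqxx andbT.
  by rewrite gt_eqF// fourier_const_gt0.
have E1 x : C (cm_re m) x + S (cm_im m) x = 0.
  by have := congr1 (@complex.Re R) (E x); rewrite /= Sscale opprK.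
have E2 x : C (cm_im m) x - S (cm_re m) x = 0.
  by have := congr1 (@complex.Im R) (E x); rewrite /= Sscale addrC.
have E1' x := E1 (- x); have E2' x := E2 (- x).
move=> A mA; rewrite /cm_value.
rewrite (@charge_transform0 (cm_re m))//; last 2 first.
- by move=> s; have := E1 s; have := E1' s; rewrite CN SN => h1 h2; lra.
- by move=> s; have := E2 s; have := E2' s; rewrite CN SN => h1 h2; lra.
rewrite (@charge_transform0 (cm_im m))//.
- by move=> s; have := E2 s; have := E2' s; rewrite CN SN => h1 h2; lra.
- by move=> s; have := E1 s; have := E1' s; rewrite CN SN => h1 h2; lra.
Qed.

Lemma fourier_sub m n : fourier (cm_lin (-1) n m) = fourier m - fourier n.
Proof.
rewrite (@fourier_lin (-1) _ n m) ?scaleN1r 1?addrC// => A mA.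
exact: cm_lin_value.
Qed.

Lemma fourier_inj m n : fourier m = fourier n ->
  forall A, measurable A -> cm_value m A = cm_value n A.
Proof.
move=> mn A mA; apply/eqP; rewrite -subr_eq0.
have := @fourier_eq0 (cm_lin (-1) n m); rewrite fourier_sub mn subrr => /(_ erefl A mA).
by rewrite cm_lin_value// mulN1r addrC => ->.
Qed.

(** By injectivity all measures representing the function have the same values, so the set from
    which [xget] picks is a singleton. *)
Lemma K_norm_fourier m : K_norm (fourier m) = c * cm_norm m.
Proof.
rewrite /K_norm; case: xgetP => [v _ [n mn ->]|/(_ (c * cm_norm m)) h].
  by congr (_ * _); apply: cm_norm_eq => A mA; exact/esym/fourier_inj.
by exfalso; apply: h; exists m.
Qed.

Definition posray : set T := `]0, +oo[%classic.

Lemma measurable_posray : measurable posray. Proof. exact: measurable_itv. Qed.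

Lemma measurable_negray : measurable (~` posray).
Proof. by apply: measurableC; exact: measurable_posray. Qed.

(* [i sgn(t) m], except that the atom at [0] is multiplied by [-i] instead of [0]. *)
Definition twist m : M_R R := cm_lin (0 +i* 1) (cm_restr m measurable_posray)
  (cm_lin (- (0 +i* 1)) (cm_restr m measurable_negray) cm0).

Lemma twist_value m A : measurable A -> cm_value (twist m) A =
  (0 +i* 1) * cm_value m (A `&` posray) + - (0 +i* 1) * cm_value m (A `&` ~` posray).
Proof.
by move=> mA; rewrite cm_lin_value// cm_lin_value// !cm_restr_value// cm_zero_value addr0.
Qed.

Lemma cm_value_sub0 m A : cm_value m [set 0] = 0 -> A `<=` [set 0] -> cm_value m A = 0.
Proof. by move=> m0 /subset_set1[->|->//]; rewrite cm_value0. Qed.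

Lemma hilbert_twist m : cm_value m [set 0] = 0 -> hilbert (fourier m) = fourier (twist m).
Proof.
move=> m0; apply/funext => x; rewrite (hilbert_fourier m x).2 /fourier; congr (_ * _).
rewrite !cm_integralE.
pose N : set T := `]-oo, 0[%classic.
have mP := measurable_posray; have mN : measurable N by exact: measurable_itv.
have m1 : measurable [set (0 : T)] by exact: measurable_set1.
have mN1 : measurable (N `|` [set (0 : T)]) by exact: measurableU.
(* On each open half-axis [sgn t] is constant, so [twist_kernel] is [i] or [- i] times the
   exponential and the factor can be moved onto the measure; on [{0}] both integrals vanish because
   [m] has no atom there. *)
have TE : [set: T] = posray `|` (N `|` [set (0 : T)]).
  apply/esym/seteqP; split => // t _; rewrite /posray /N /= !in_itv /= andbT.
  by case: (ltgtP 0 t) => [h|h|h]; [left|right; left|right; right].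
have d1 : [disjoint posray & N `|` [set (0 : T)]].
  apply/disj_setPS => t [/=]; rewrite /posray /N /= !in_itv /= andbT => t0 [t1|t1].
    by have := lt_trans t0 t1; rewrite ltxx.
  by move: t0; rewrite t1 ltxx.
have d2 : [disjoint N & [set (0 : T)]].
  by apply/disj_setPS => t [/=]; rewrite /N /= in_itv /= => + t0; rewrite t0 ltxx.
have bt D : measurable D -> cbmeasurable D (twist_kernel x : T -> R[i]).
  exact: cbmeasurable_twist.
have be D : measurable D -> cbmeasurable D (fun t : T => expmi (x * t)).
  exact: cbmeasurable_expmi.
have mPN := measurableU _ _ mP mN1.
rewrite TE !cm_integral_onU//; [|exact: be|exact: be|exact: bt|exact: bt].
congr (_ + (_ + _)).
- rewrite (@cm_integral_on_lin _ _ _ (0 +i* 1) (twist m) m cm0)//; last 2 first.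
  + exact: be.
  + move=> A mA AP; rewrite twist_value// (setIidl AP) cm_zero_value.
    have -> : A `&` ~` posray = set0 by rewrite -subset0 => t [/AP ? /(_ _)]; exact.
    by rewrite cm_value0 mulr0.
  rewrite (@cm_integral_on0 _ _ _ cm0)// ?addr0; last exact: be.
  rewrite -cm_integral_onZ//; last exact: be.
  apply: eq_cm_integral_on => t; rewrite inE /posray /= in_itv /= andbT => t0.
  by apply: complex_eqP; rewrite ?Re_mulc ?Im_mulc /= gtr0_sg//; ring.
- rewrite (@cm_integral_on_lin _ _ _ (- (0 +i* 1)) (twist m) m cm0)//; last 2 first.
  + exact: be.
  + move=> A mA AP; rewrite twist_value// cm_zero_value.
    have AnP : A `<=` ~` posray.
      move=> t /AP; rewrite /N /posray /= !in_itv /= andbT => t0 t1.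
      by have := lt_trans t0 t1; rewrite ltxx.
    have -> : A `&` posray = set0 by rewrite -subset0 => t [/AnP].
    by rewrite (setIidl AnP) cm_value0 mulr0 add0r addr0.
  rewrite (@cm_integral_on0 _ _ _ cm0)// ?addr0; last exact: be.
  rewrite -cm_integral_onZ//; last exact: be.
  apply: eq_cm_integral_on => t; rewrite inE /N /= in_itv /= => t0.
  by apply: complex_eqP; rewrite ?Re_mulc ?Im_mulc /= ltr0_sg//; ring.
- rewrite (@cm_integral_on0 _ _ _ m)//; last 2 first.
  + exact: bt.
  + by move=> A mA A0; exact: cm_value_sub0.
  rewrite cm_integral_on0//; first exact: be.
  move=> A mA A0; rewrite twist_value//.
  have s1 : A `&` posray `<=` [set 0] by move=> t [/A0].
  have s2 : A `&` ~` posray `<=` [set 0] by move=> t [/A0].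
  by rewrite (cm_value_sub0 m0 s1) (cm_value_sub0 m0 s2) !mulr0 addr0.
Qed.

End FourierSpace.

(** * The Banach space K and its decomposition *)

Section KSpace.
Context {R : realType}.
Notation T := (measurableTypeR R).
Implicit Types m n : M_R R.
Notation cm0 := (@cm_zero R _ T).
Notation c := ((Num.sqrt (2 * pi))^-1 : R).

Lemma K_space_fourier m : K_space (fourier m).
Proof. by exists m. Qed.

Lemma fourier_cm_lin (a : R[i]) m n : fourier (cm_lin a m n) = a *: fourier m + fourier n.
Proof. by apply: fourier_lin => A mA; exact: cm_lin_value. Qed.

Lemma K_space_subspace : is_subspace (@K_space R).
Proof.
split; first by exists cm0; rewrite fourier_zero.
by move=> a f g [m ->] [n ->]; exists (cm_lin a m n); rewrite fourier_cm_lin.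
Qed.

Lemma K_norm_on : is_norm_on (@K_space R) K_norm.
Proof.
split.
- move=> f [m ->]; rewrite K_norm_fourier => /eqP.
  rewrite mulf_eq0 gt_eqF ?fourier_const_gt0//= => /eqP m0.
  rewrite -fourier_zero; apply: fourier_ext => A mA; rewrite cm_zero_value.
  apply: ComplexField.Normc.eq0_normc; apply/eqP; rewrite eq_le normc_ge0 andbT -m0.
  exact: cm_value_le.
- move=> a f [m ->].
  have -> : a *: fourier m = fourier (cm_lin a m cm0) by rewrite fourier_cm_lin fourier_zero addr0.
  rewrite !K_norm_fourier mulrCA; congr (_ * _); apply: cm_norm_scale => A mA.
  by rewrite cm_lin_value// cm_zero_value addr0.
- move=> f g [m ->] [n ->]; rewrite -[X in X + _]scale1r -fourier_cm_lin !K_norm_fourier.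
  rewrite -mulrDr ler_pM2l ?fourier_const_gt0//.
  have := @cm_norm_lin_le R _ _ 1 (cm_lin 1 m n) m n.
  rewrite ComplexField.Normc.normc1 mul1r; apply => A mA.
  exact: cm_lin_value.
Qed.

Lemma K_norm_sub m n : K_norm (fourier m - fourier n) = c * cm_norm (cm_lin (-1) n m).
Proof. by rewrite -fourier_sub K_norm_fourier. Qed.

Lemma K_space_complete : is_complete (@K_space R) K_norm.
Proof.
move=> u uK cauchy; have [m_ um] := choice uK.
have [|m Hm] := @cm_complete R _ _ m_.
  move=> e e0; have ce0 : 0 < c * e by rewrite mulr_gt0// fourier_const_gt0.
  have [N HN] := cauchy _ ce0; exists N => i j Ni Nj.
  by have := HN i j Ni Nj; rewrite !um K_norm_sub ltr_pM2l// fourier_const_gt0.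
exists (fourier m); first exact: K_space_fourier.
under eq_cvg => k do rewrite um K_norm_sub.
have h : c * cm_norm (cm_lin (-1) m (m_ k)) @[k --> \oo] --> c * 0 by exact: cvgMl_tmp.
by rewrite mulr0 in h.
Qed.

Lemma K_space_banach : is_banach_space (@K_space R) K_norm.
Proof. by split; [exact: K_space_subspace|exact: K_norm_on|exact: K_space_complete]. Qed.

Lemma cm_integral_on1 m (D : set T) : measurable D -> cm_integral_on m D (fun=> 1) = cm_value m D.
Proof.
move=> mD.
have e1 (nu : {charge set T -> \bar R}) (k : R) :
    charge_integral_on nu D (fun=> k) = k * fine (nu D).
  by rewrite charge_partE// mulrBr -!Rintegral_cst.
by rewrite /cm_integral_on /= !e1 !mul1r !mul0r subr0 add0r.
Qed.

Lemma measurable_zero : measurable [set (0 : T)].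
Proof. exact: measurable_set1. Qed.

Let cbmeasurableW (D : set T) (f : T -> R[i]) : cbmeasurable setT f -> cbmeasurable D f.
Proof.
move=> [[m1 [M1 b1]] [m2 [M2 b2]]]; split; split; try exact: measurable_funTS.
  by exists M1 => x _; exact: b1.
by exists M2 => x _; exact: b2.
Qed.

Lemma cm_integral_atom m (f : T -> R[i]) : cbmeasurable [set: T] f -> concentrated_on m [set 0] ->
  cm_integral m f = f 0 * cm_value m [set 0].
Proof.
move=> bf m0; have mz := measurable_zero; have mzC := measurableC mz.
rewrite cm_integralE -(setvU [set (0 : T)]) cm_integral_onU//; last 2 first.
- by apply/disj_setPS => t [].
- by rewrite setvU.
rewrite cm_integral_on0// ?add0r; last 2 first.
- exact: cbmeasurableW.
- by move=> A mA A0; apply: m0 => //; rewrite -subset0 => t [/A0].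
have b1 : cbmeasurable [set (0 : T)] (fun=> 1 : R[i]).
  split; split => //=.
    by exists 1 => t _; rewrite normr1.
  by exists 0 => t _; rewrite normr0.
rewrite -cm_integral_on1// -cm_integral_onZ//.
by apply: eq_cm_integral_on => t; rewrite inE => ->; rewrite mulr1.
Qed.

Lemma fourier_atom m : concentrated_on m [set 0] -> fourier m = fun=> c%:C * cm_value m [set 0].
Proof.
move=> m0; apply/funext => x; rewrite /fourier; congr (_ * _).
rewrite (@cm_integral_atom m (fun t => expmi (x * t)))//; last exact: cbmeasurable_expmi.
have -> : expmi (x * 0) = 1 :> R[i].
  by apply: complex_eqP; rewrite /= mulr0 ?cos0// sin0 oppr0.
by rewrite mul1r.
Qed.

Let cC0 : c%:C != 0 :> R[i].
Proof. by rewrite eq_complex /= eqxx andbT gt_eqF// fourier_const_gt0. Qed.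

(** A point mass at [0], scaled to undo the normalisation of the transform. *)
Definition const_measure (a : R[i]) : M_R R := cm_lin (c%:C^-1 * a) (@cm_dirac R _ T 0) cm0.

Lemma const_measure_value (a : R[i]) (A : set T) : measurable A ->
  cm_value (const_measure a) A = c%:C^-1 * a * (0 \in A)%:R.
Proof. by move=> mA; rewrite cm_lin_value// cm_dirac_value cm_zero_value addr0. Qed.

Lemma const_measure_concentrated (a : R[i]) : concentrated_on (const_measure a) [set 0].
Proof.
move=> A mA A0; rewrite const_measure_value// memNset ?mulr0// => A0'.
by have : (A `&` [set 0]) 0 by []; rewrite A0.
Qed.

Lemma fourier_const_measure (a : R[i]) : fourier (const_measure a) = fun=> a.
Proof.
rewrite fourier_atom; last exact: const_measure_concentrated.
apply/funext => x; rewrite const_measure_value; last exact: measurable_zero.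
by rewrite mem_set// mulr1 mulrA mulfV// mul1r.
Qed.

(** The value on a fixed set is continuous for the norm. Closedness of both summands follows: [A1]
    and [A2] consist of transforms of measures that vanish on prescribed sets, those avoiding [0]
    for [A1] and [{0}] for [A2]. *)
Lemma cm_value_limit (m_ : nat -> M_R R) m (A : set T) : measurable A ->
  (fun k => K_norm (fourier (m_ k) - fourier m)) @ \oo --> (0 : R) ->
  (forall k, cm_value (m_ k) A = 0) -> cm_value m A = 0.
Proof.
move=> mA h z; apply: ComplexField.Normc.eq0_normc; apply/eqP.
rewrite eq_le normc_ge0 andbT; apply/ler_addgt0Pr => e e0; rewrite add0r.
have ce0 : 0 < c * e by rewrite mulr_gt0// fourier_const_gt0.
move/cvgrPdist_le : h => /(_ _ ce0)[N _ /(_ N (leqnn N))] /=.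
rewrite sub0r normrN K_norm_sub normrM (gtr0_norm fourier_const_gt0).
rewrite ler_pM2l ?fourier_const_gt0// => h.
apply: le_trans (le_trans (ler_norm _) h).
apply: le_trans (cm_value_le _ mA); rewrite cm_lin_value// z addr0 mulN1r.
by rewrite normc_opp.
Qed.

Lemma A1_closed : is_closed_subspace (@K_space R) K_norm A1_space.
Proof.
split.
- split; first by exists 0.
  by move=> a f g [x ->] [y ->]; exists (a * x + y).
- by move=> f [x ->]; exists (const_measure x); rewrite fourier_const_measure.
- move=> u f uA [m ->] h.
  have {uA} [a ua] := choice uA.
  have {}h : (fun k => K_norm (fourier (const_measure (a k)) - fourier m)) @ \oo --> (0 : R).
    by under eq_cvg => k do rewrite fourier_const_measure -ua.
  exists (c%:C * cm_value m [set 0]); apply: fourier_atom => A mA A0.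
  by apply: (cm_value_limit mA h) => k; exact: const_measure_concentrated.
Qed.

Lemma A2_closed : is_closed_subspace (@K_space R) K_norm A2_space.
Proof.
split.
- split; first by exists cm0; [rewrite fourier_zero|rewrite cm_zero_value].
  move=> a f g [m -> m0] [n -> n0]; exists (cm_lin a m n); first by rewrite fourier_cm_lin.
  by rewrite cm_lin_value ?m0 ?n0 ?mulr0 ?addr0//; exact: measurable_zero.
- by move=> f [m -> _]; exists m.
- move=> u f uA [m ->] h.
  have {}uA k : exists m' : M_R R, u k = fourier m' /\ cm_value m' [set 0] = 0.
    by have [m' ? ?] := uA k; exists m'.
  have [m_ um] := choice uA.
  have {}h : (fun k => K_norm (fourier (m_ k) - fourier m)) @ \oo --> (0 : R).
    by under eq_cvg => k do rewrite -(um k).1.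
  exists m => //; apply: (cm_value_limit measurable_zero h) => k.
  exact: (um k).2.
Qed.

(** The decomposition restricts the measure to [{0}] and to its complement. A constant in [A2] is
    represented both by a point mass and by a measure without atom at [0], so injectivity forces it
    to be [0]. *)
Lemma A1_A2_direct_sum : is_direct_sum (@K_space R) K_norm A1_space A2_space.
Proof.
have [[K0 KD] [_ A1K _] [_ A2K _]] := And3 K_space_subspace A1_closed A2_closed.
have mz := measurable_zero; have mzC := measurableC mz.
split; [exact: A1_closed|exact: A2_closed| |].
- apply/seteqP; split => f.
    move=> [m ->]; exists (fourier (cm_restr m mz)), (fourier (cm_restr m mzC)); split.
    + exists (c%:C * cm_value (cm_restr m mz) [set 0]); apply: fourier_atom => A mA A0.
      by rewrite cm_restr_value// A0 cm_value0.
    + by exists (cm_restr m mzC) => //; rewrite cm_restr_value// setICr cm_value0.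
    + rewrite -[X in X + _]scale1r -fourier_cm_lin; apply: fourier_ext => A mA.
      by rewrite cm_lin_value// !cm_restr_value// mul1r -cm_value_split.
  move=> [g [h [/A1K gK /A2K hK ->]]].
  by rewrite -[g]scale1r; exact: KD.
- apply/seteqP; split => f.
    move=> [[a ->] [m am m0]] /=.
    have := @fourier_inj R (const_measure a) m.
    rewrite fourier_const_measure => /(_ am _ mz).
    rewrite const_measure_value// m0 mem_set// mulr1 => /eqP.
    by rewrite mulf_eq0 invr_eq0 (negbTE cC0)/= => /eqP ->.
  move=> ->; split; first by exists 0.
  by exists cm0; [rewrite fourier_zero|rewrite cm_zero_value].
Qed.

Lemma hilbert_linear (a : R[i]) (f g : R -> R[i]) : K_space f -> K_space g ->
  hilbert (a *: f + g) = a *: hilbert f + hilbert g.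
Proof.
move=> [m ->] [n ->]; rewrite -fourier_cm_lin; apply/funext => x.
rewrite [RHS]/(a * hilbert (fourier m) x + hilbert (fourier n) x) !(hilbert_fourier _ _).2.
rewrite !cm_integralE (@cm_integral_on_lin _ _ _ a (cm_lin a m n) m n)//.
- by rewrite mulrDr mulrCA.
- exact: cbmeasurable_twist.
- by move=> A mA _; exact: cm_lin_value.
Qed.

Lemma hilbert_A1 (f : R -> R[i]) : A1_space f -> hilbert f = 0.
Proof.
move=> [a ->]; rewrite -fourier_const_measure; apply/funext => x.
rewrite (hilbert_fourier _ _).2 (@cm_integral_atom _ (twist_kernel x)); last 2 first.
- exact: cbmeasurable_twist.
- exact: const_measure_concentrated.
have -> : twist_kernel x 0 = 0 by rewrite /twist_kernel sgr0 !mul0r.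
by rewrite mul0r mulr0.
Qed.

Let mulii : (0 +i* 1) * (0 +i* 1) = -1 :> R[i].
Proof. by apply: complex_eqP; rewrite /=; ring. Qed.

(** Both [i] and [- i] square to [-1], so this holds for an atom at [0] too; that is the benefit of
    giving the atom the factor [- i] in [twist]. *)
Lemma twist_twist m (A : set T) : measurable A -> cm_value (twist (twist m)) A = - cm_value m A.
Proof.
move=> mA; have mP := measurable_posray (R := R); have mN := measurable_negray (R := R).
have mAP := measurableI _ _ mA mP; have mAN := measurableI _ _ mA mN.
rewrite (cm_value_split m mA mP) !twist_value// -!setIA.
rewrite !setIid setICr setICl !setI0 !cm_value0 !mulr0 addr0 add0r.
by rewrite !mulrA mulrNN mulii !mulN1r opprD.
Qed.

(** Twisting does not increase the norm, and twisting twice is a change of sign, so it cannot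
    decrease the norm either. *)
Lemma cm_norm_twist m : cm_norm (twist m) = cm_norm m.
Proof.
have mP := measurable_posray (R := R).
have n1 : normc (0 +i* 1 : R[i]) <= 1.
  by rewrite /ComplexField.Normc.normc expr0n /= add0r expr1n sqrtr1.
have le n : cm_norm (twist n) <= cm_norm n.
  apply: (cm_norm_twist_le mP n1 (b := - (0 +i* 1))); first by rewrite normc_opp.
  by move=> A mA; exact: twist_value.
apply/eqP; rewrite eq_le le/=.
rewrite (@cm_norm_scale R _ _ (-1) m (twist (twist m))); last first.
  by move=> A mA; rewrite twist_twist// mulN1r opprK.
by rewrite normc_opp ComplexField.Normc.normc1 mul1r.
Qed.

Lemma twist_atom m : cm_value m [set 0] = 0 -> cm_value (twist m) [set 0] = 0.
Proof.
move=> m0; rewrite twist_value; last exact: measurable_zero.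
by rewrite !(cm_value_sub0 m0) ?mulr0 ?addr0//; move=> t [].
Qed.

Lemma hilbert_isometry (f : R -> R[i]) : A2_space f -> K_norm (hilbert f) = K_norm f.
Proof. by move=> [m -> m0]; rewrite hilbert_twist// !K_norm_fourier cm_norm_twist. Qed.

Lemma hilbert_A2 : [set hilbert f | f in @A2_space R] = A2_space.
Proof.
apply/seteqP; split => f.
  move=> [g [m -> m0] <-]; rewrite hilbert_twist//.
  by exists (twist m) => //; exact: twist_atom.
(* The square of the twist is [-1], so its inverse is minus the twist. *)
move=> [m -> m0]; pose n := cm_lin (-1) (twist m) cm0.
have nE A : measurable A -> cm_value n A = - cm_value (twist m) A.
  by move=> mA; rewrite cm_lin_value// cm_zero_value addr0 mulN1r.
have n0 : cm_value n [set 0] = 0.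
  by rewrite nE ?twist_atom ?oppr0//; exact: measurable_zero.
exists (fourier n); first by exists n.
rewrite hilbert_twist//; apply: fourier_ext => A mA.
have mP := measurable_posray (R := R); have mN := measurable_negray (R := R).
have mAP := measurableI _ _ mA mP; have mAN := measurableI _ _ mA mN.
by rewrite twist_value// !nE// !mulrN -opprD -twist_value// twist_twist// opprK.
Qed.

Lemma hilbert_eigen m : concentrated_on m [set t : R | t < 0] \/
  concentrated_on m [set t : R | 0 < t] -> is_hilbert_eigenfunction (fourier m).
Proof.
move=> H; split; first by move=> x; exact: (hilbert_fourier m x).1.
have mz := measurable_zero.
(* Both half-axes are open and miss [0]. *)
have m0 : cm_value m [set 0] = 0.
  by case: H => H; apply: H => //; rewrite -subset0 => t /= [->]; rewrite ltxx.
rewrite hilbert_twist//.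
suff [lam Hlam] : exists lam : R[i], forall A, measurable A -> cm_value (twist m) A = lam * cm_value m A.
  exists lam; rewrite (@fourier_lin R lam _ m cm0) ?fourier_zero ?addr0// => A mA.
  by rewrite cm_zero_value addr0 Hlam.
have mP := measurable_posray (R := R); have mN := measurable_negray (R := R).
case: H => H; [exists (- (0 +i* 1))|exists (0 +i* 1)] => A mA;
  have mAP := measurableI _ _ mA mP; have mAN := measurableI _ _ mA mN;
  rewrite twist_value// [in RHS](cm_value_split m mA mP).
- rewrite (H _ mAP) ?mulr0 ?add0r// -subset0 => t /= [[_]].
  by rewrite /posray /= in_itv /= andbT => t0 t1; have := lt_trans t0 t1; rewrite ltxx.
- rewrite (H _ mAN) ?mulr0 ?addr0// -subset0 => t /= [[_]].
  by rewrite /posray /= in_itv /= andbT.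
Qed.

Lemma A2_eigen_decomposition (f : R -> R[i]) : A2_space f -> exists g h : R -> R[i],
  [/\ A2_space g, A2_space h, is_hilbert_eigenfunction g, is_hilbert_eigenfunction h & f = g + h].
Proof.
move=> [m -> m0].
have mP := measurable_posray (R := R); have mN := measurable_negray (R := R).
exists (fourier (cm_restr m mP)), (fourier (cm_restr m mN)); split.
- exists (cm_restr m mP) => //; rewrite cm_restr_value; last exact: measurable_zero.
  by apply: cm_value_sub0 => // t [].
- exists (cm_restr m mN) => //; rewrite cm_restr_value; last exact: measurable_zero.
  by apply: cm_value_sub0 => // t [].
- apply: hilbert_eigen; right => A mA A0; rewrite cm_restr_value//.
  suff -> : A `&` posray = set0 by rewrite cm_value0.
  rewrite -A0; apply/seteqP; split => t [At]; rewrite /posray /= in_itv /= andbT => h;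
    by split.
(* The second summand lives on the closed half-axis [t <= 0]; as [m] has no atom at [0], it is
   concentrated on the open one. *)
- apply: hilbert_eigen; left => A mA A0; rewrite cm_restr_value//.
  apply: cm_value_sub0 => // t [At]; rewrite /posray /= in_itv /= andbT => /negP.
  rewrite -leNgt le_eqVlt => /predU1P[//|t0].
  by have : (A `&` [set t : R | t < 0]) t by []; rewrite A0.
- rewrite -[X in X + _]scale1r -fourier_cm_lin; apply: fourier_ext => A mA.
  by rewrite cm_lin_value// !cm_restr_value// mul1r -cm_value_split.
Qed.

End KSpace.

Unset Implicit Arguments.
Set Strict Implicit.
Set Printing Implicit Defensive.

Theorem mainTheorem7 (R : realType) :
  [/\ (* K(R) is a Banach space and K(R) = A1 (+) A2 *)
      [/\ forall mu : M_R R,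
            K_norm (fourier mu) = (Num.sqrt (2 * pi))^-1 * cm_norm mu,
          is_banach_space (@K_space R) K_norm &
          is_direct_sum (@K_space R) K_norm A1_space A2_space],
      (* H is a well defined linear operator on K(R), vanishing on A1 *)
      [/\ forall f : R -> R[i], K_space f -> forall x, hilbert_defined_at f x,
          forall (a : R[i]) (f g : R -> R[i]), K_space f -> K_space g ->
            hilbert (a *: f + g) = a *: hilbert f + hilbert g &
          forall f : R -> R[i], A1_space f -> hilbert f = 0],
      (* H is isometric on A2 and H A2 = A2 *)
      (forall f : R -> R[i], A2_space f -> K_norm (hilbert f) = K_norm f) /\
      [set hilbert f | f in @A2_space R] = A2_space,
      (* measures concentrated on an open half-axis give eigenfunctions *)
      (forall (f : R -> R[i]) (mu : M_R R), A2_space f -> f = fourier mu ->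
         concentrated_on mu [set t : R | t < 0] \/
         concentrated_on mu [set t : R | 0 < t] ->
         is_hilbert_eigenfunction f) &
      (* every function in A2 is a sum of two eigenfunctions *)
      (forall f : R -> R[i], A2_space f ->
         exists g h : R -> R[i],
           [/\ A2_space g, A2_space h, is_hilbert_eigenfunction g,
               is_hilbert_eigenfunction h & f = g + h])].
Proof.
split.
- split; [exact: K_norm_fourier|exact: K_space_banach|exact: A1_A2_direct_sum].
- split; [|exact: hilbert_linear|exact: hilbert_A1].
  by move=> f [m ->] x; have [] := hilbert_fourier m x.
- by split; [exact: hilbert_isometry|exact: hilbert_A2].
- by move=> f m _ ->; exact: hilbert_eigen.
- exact: A2_eigen_decomposition.
Qed.
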